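(* Let $\mathcal{E}$ be a system of abstract semantic equations (with respect to a fixed template constraint matrix $T\in\mathbb{R}^{m\times n}$) with variable set $\mathbf{X}$, whose least solution $\mu[\![\mathcal{E}]\!]$ satisfies $\mu[\![\mathcal{E}]\!](\mathbf{x})<\infty$ for all $\mathbf{x}\in\mathbf{X}$. Let $\Sigma$ be the set of all $\vee$-strategies for $\mathcal{E}$. Then the strategy improvement algorithm computes $\mu[\![\mathcal{E}]\!]$ and performs at most $|\Sigma|+|\mathbf{X}|$ strategy improvement steps. For each strategy improvement step, one has to do the following: (1) find models for $|\mathbf{X}|$ SAT modulo real linear arithmetic formulas, each of which can be constructed in linear time; (2) solve a linear programming problem which can be constructed in linear time.
   Context: Write $\overline{\mathbb{R}}=\mathbb{R}\cup\{-\infty,\infty\}$. Statements. Let $x=(x_1,\dots,x_n)^\top$ be the vector of real program variables. Statements are built from affine assignments $x:=Ax+b$ ($A\in\mathbb{R}^{n\times n}$, $b\in\mathbb{R}^n$) and affine guards $Ax\le b$ ($A\in\mathbb{R}^{k\times n}$, $b\in\mathbb{R}^k$) (the elementary statements) using sequencing $s_1;s_2$ and nondeterministic choice $s_1\mid s_2$. A statement not containing $\mid$ is called sequential. The collecting semantics $[\![s]\!]:2^{\mathbb{R}^n}\to2^{\mathbb{R}^n}$ is $[\![x:=Ax+b]\!]X=\{Ax+b\mid x\in X\}$, $[\![Ax\le b]\!]X=\{x\in X\mid Ax\le b\}$, $[\![s_1;s_2]\!]=[\![s_2]\!]\circ[\![s_1]\!]$, $[\![s_1\mid s_2]\!]X=[\![s_1]\!]X\cup[\![s_2]\!]X$.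 Abstract semantics. For $T\in\mathbb{R}^{m\times n}$ put $\gamma(d)=\{x\in\mathbb{R}^n\mid Tx\le d\}$ for $d\in\overline{\mathbb{R}}^m$, $\alpha(X)=\bigwedge\{d\in\overline{\mathbb{R}}^m\mid\gamma(d)\supseteq X\}$ for $X\subseteq\mathbb{R}^n$, and $[\![s]\!]^\sharp=\alpha\circ[\![s]\!]\circ\gamma:\overline{\mathbb{R}}^m\to\overline{\mathbb{R}}^m$; $[\![s]\!]^\sharp_{j\cdot}$ denotes its $j$-th component. Equations. A system of abstract semantic equations is a finite set $\mathcal{E}=\{\mathbf{x}_1=e_1,\dots,\mathbf{x}_r=e_r\}$ with pairwise distinct variables, where each $e_i$ has the form $e_{i,1}\vee\dots\vee e_{i,k_i}$ and each $e_{i,l}$ is either a constant in $\overline{\mathbb{R}}$ or an expression $[\![s]\!]^\sharp_{j\cdot}(\mathbf{y}_1,\dots,\mathbf{y}_m)$ with $s$ a statement, $1\le j\le m$, and $\mathbf{y}_1,\dots,\mathbf{y}_m$ variables of the system. $\mathbf{X}$ is the set of variables. For a variable assignment $\rho:\mathbf{X}\to\overline{\mathbb{R}}$, $[\![e]\!]\rho$ is the value of $e$ under $\rho$, and $([\![\mathcal{E}]\!]\rho)(\mathbf{x})=[\![e]\!]\rho$ for $\mathbf{x}=e\in\mathcal{E}$. $\rho$ is a solution if $\rho=[\![\mathcal{E}]\!]\rho$ and a pre-solution if $\rho\le[\![\mathcal{E}]\!]\rho$ (pointwise); $\mu[\![\mathcal{E}]\!]$ is the least solution, and for a pre-solution $\rho$,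 $\mu_{\ge\rho}[\![\mathcal{E}]\!]$ is the least solution that is $\ge\rho$. For assignments, $\rho>\rho'$ means $\rho\ge\rho'$ and $\rho\ne\rho'$. $\vee$-strategies. A $\vee$-strategy $\sigma$ for a statement $s$ maps each position of a subexpression of $s$ of the form $s_0\mid s_1$ to $0$ or $1$; $s\sigma$ is the sequential statement obtained by replacing every such $s_0\mid s_1$ by $s_{\sigma(\mathrm{pos}(s_0\mid s_1))}$, recursively. A $\vee$-strategy for $[\![s]\!]^\sharp_{j\cdot}(\mathbf{y}_1,\dots,\mathbf{y}_m)$ is a $\vee$-strategy for $s$, with $([\![s]\!]^\sharp_{j\cdot}(\mathbf{y}_1,\dots,\mathbf{y}_m))\sigma=[\![s\sigma]\!]^\sharp_{j\cdot}(\mathbf{y}_1,\dots,\mathbf{y}_m)$; a constant $c$ has only the empty strategy $()$, with $c()=c$. A $\vee$-strategy for $e=e_1\vee\dots\vee e_k$ is a pair $(p,\sigma)$ with $p$ an index and $\sigma$ a $\vee$-strategy for $e_p$, with $e(p,\sigma)=e_p\sigma$. A $\vee$-strategy $\sigma$ for $\mathcal{E}$ assigns to each variable $\mathbf{x}$ with equation $\mathbf{x}=e$ a $\vee$-strategy $\sigma(\mathbf{x})$ for $e$; $\mathcal{E}(\sigma)=\{\mathbf{x}=e(\sigma(\mathbf{x}))\mid\mathbf{x}=e\in\mathcal{E}\}$. Improvement. Let $\rho$ be a pre-solution of $\mathcal{E}(\sigma)$. $\sigma'$ is an improvement of $\sigma$ w.r.t. $\rho$ iff (i) if $\rho$ is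 not a solution of $\mathcal{E}$ then $[\![\mathcal{E}(\sigma')]\!]\rho>\rho$; and (ii) for every right-hand side $e$ on which $\sigma'$ and $\sigma$ differ, the value under $\rho$ of $e$ with $\sigma'$ applied is strictly greater than the value under $\rho$ of $e$ with $\sigma$ applied. Strategy improvement algorithm. It is run on the system $\mathcal{E}\vee-\infty:=\{\mathbf{x}=e\vee-\infty\mid\mathbf{x}=e\in\mathcal{E}\}$, starting with the $\vee$-strategy $\sigma$ that selects $-\infty$ in every equation and with $\rho$ the constant assignment $-\infty$. While $\rho$ is not a solution of the system, it performs a strategy improvement step: replace $\sigma$ by an improvement of $\sigma$ w.r.t. $\rho$ (determined using a solver for SAT modulo real linear arithmetic), then replace $\rho$ by $\mu_{\ge\rho}[\![(\mathcal{E}\vee-\infty)(\sigma)]\!]$ (determined by linear programming). When the loop ends it returns $\rho$. SAT modulo real linear arithmetic formulas are Boolean combinations of Boolean variables and (non-strict or strict) linear inequalities between real-valued linear expressions in real variables; a model is an assignment of real values to real variables and Boolean values to Boolean variables making the formula true. A linear programming problem is $\sup\{c^\top x\mid x\in\mathbb{R}^N, Ax\le b\}$. *)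

(* Defs.v *)
From HB Require Import structures.
From mathcomp Require Import all_boot all_order all_algebra.
From mathcomp Require Import all_classical all_reals.
From mathcomp Require Import ereal.

Set Implicit Arguments.
Unset Strict Implicit.
Unset Printing Implicit Defensive.
Import Order.TTheory GRing.Theory Num.Theory.
Local Open Scope classical_set_scope.
Local Open Scope ring_scope.

(** * Statements and their collecting semantics *)

Inductive stmt (R : realType) (n : nat) : Type :=
| Assign of 'M[R]_n & 'cV[R]_n
| Guard (k : nat) of 'M[R]_(k, n) & 'cV[R]_k
| Seq of stmt R n & stmt R n
| Choice of stmt R n & stmt R n.

Arguments Guard {R n k}.

Fixpoint sem (R : realType) (n : nat) (s : stmt R n) (X : set 'cV[R]_n)
    : set 'cV[R]_n :=
  match s with
  | Assign A b => [set A *m x + b | x in X]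
  | Guard k A b => [set x | X x /\ forall i, (A *m x) i 0 <= b i 0]
  | Seq s1 s2 => sem s2 (sem s1 X)
  | Choice s1 s2 => sem s1 X `|` sem s2 X
  end.

(** * Abstract semantics with respect to a template [T] *)

Definition gamma (R : realType) (m n : nat) (T : 'M[R]_(m, n))
    (d : 'I_m -> \bar R) : set 'cV[R]_n :=
  [set x | forall i, (((T *m x) i 0)%:E <= d i)%E].

(* Infima in [\bar R^m] are componentwise. *)
Definition alpha (R : realType) (m n : nat) (T : 'M[R]_(m, n))
    (X : set 'cV[R]_n) : 'I_m -> \bar R :=
  fun j => ereal_inf [set d j | d in [set d | X `<=` gamma T d]].

Definition abs_sem (R : realType) (m n : nat) (T : 'M[R]_(m, n))
    (s : stmt R n) (d : 'I_m -> \bar R) : 'I_m -> \bar R :=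
  alpha T (sem s (gamma T d)).

(** * Systems of abstract semantic equations over the variables ['I_r] *)

Inductive aexp (R : realType) (n m r : nat) : Type :=
| Const of \bar R
| Abs of stmt R n & 'I_m & ('I_m -> 'I_r).

Arguments Const {R n m r}.

(* A right-hand side e_1 \/ ... \/ e_k is the list of its disjuncts. *)
Definition rhs (R : realType) (n m r : nat) : Type := seq (aexp R n m r).

Definition system (R : realType) (n m r : nat) : Type := 'I_r -> rhs R n m r.

Definition assignment (R : realType) (r : nat) : Type := 'I_r -> \bar R.

Definition aexp_val (R : realType) (n m r : nat) (T : 'M[R]_(m, n))
    (a : aexp R n m r) (rho : assignment R r) : \bar R :=
  match a with
  | Const c => c
  | Abs s j y => abs_sem T s (fun i => rho (y i)) j
  end.

Definition rhs_val (R : realType) (n m r : nat) (T : 'M[R]_(m, n))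
    (e : rhs R n m r) (rho : assignment R r) : \bar R :=
  \big[maxe/-oo%E]_(a <- e) aexp_val T a rho.

Definition sys_val (R : realType) (n m r : nat) (T : 'M[R]_(m, n))
    (E : system R n m r) (rho : assignment R r) : assignment R r :=
  fun x => rhs_val T (E x) rho.

Definition asg_le (R : realType) (r : nat) (rho rho' : assignment R r) : Prop :=
  forall x, (rho x <= rho' x)%E.

Definition asg_lt (R : realType) (r : nat) (rho rho' : assignment R r) : Prop :=
  asg_le rho rho' /\ rho <> rho'.

Definition solution (R : realType) (n m r : nat) (T : 'M[R]_(m, n))
    (E : system R n m r) (rho : assignment R r) : Prop :=
  rho = sys_val T E rho.

Definition presolution (R : realType) (n m r : nat) (T : 'M[R]_(m, n))
    (E : system R n m r) (rho : assignment R r) : Prop :=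
  asg_le rho (sys_val T E rho).

Definition least_solution (R : realType) (n m r : nat) (T : 'M[R]_(m, n))
    (E : system R n m r) (mu : assignment R r) : Prop :=
  solution T E mu /\ forall rho, solution T E rho -> asg_le mu rho.

Definition least_solution_ge (R : realType) (n m r : nat) (T : 'M[R]_(m, n))
    (E : system R n m r) (rho mu : assignment R r) : Prop :=
  [/\ solution T E mu, asg_le rho mu &
      forall nu, solution T E nu -> asg_le rho nu -> asg_le mu nu].

(** * Strategies *)

(* A position is the path from the root: [false] leads to the left operand of
   [Seq] or [Choice], [true] to the right one.  The list is in preorder. *)
Fixpoint choice_pos (R : realType) (n : nat) (s : stmt R n) : seq (seq bool) :=
  match s with
  | Assign _ _ => [::]
  | Guard _ _ _ => [::]
  | Seq s0 s1 =>
      map (cons false) (choice_pos s0) ++ map (cons true) (choice_pos s1)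
  | Choice s0 s1 =>
      [::] :: map (cons false) (choice_pos s0) ++ map (cons true) (choice_pos s1)
  end.

Definition aexp_pos (R : realType) (n m r : nat) (a : aexp R n m r)
    : seq (seq bool) :=
  match a with Const _ => [::] | Abs s _ _ => choice_pos s end.

Definition strat_aexp (R : realType) (n m r : nat) (a : aexp R n m r) : finType :=
  {ffun seq_sub (aexp_pos a) -> bool}.

Definition strat_rhs (R : realType) (n m r : nat) (e : rhs R n m r) : finType :=
  {l : 'I_(size e) & strat_aexp (tnth (in_tuple e) l)}.

Definition strategy (R : realType) (n m r : nat) (E : system R n m r) : finType :=
  {dffun forall x : 'I_r, strat_rhs (E x)}.

Definition strat_fun (R : realType) (n m r : nat) (a : aexp R n m r)
    (f : strat_aexp a) (p : seq bool) : bool :=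
  if insub p is Some q then f q else false.

Fixpoint stmt_app (R : realType) (n : nat) (s : stmt R n) (f : seq bool -> bool)
    : stmt R n :=
  match s with
  | Assign A b => Assign A b
  | Guard k A b => Guard A b
  | Seq s0 s1 =>
      Seq (stmt_app s0 (fun p => f (false :: p)))
          (stmt_app s1 (fun p => f (true :: p)))
  | Choice s0 s1 =>
      if f [::] then stmt_app s1 (fun p => f (true :: p))
      else stmt_app s0 (fun p => f (false :: p))
  end.

Definition aexp_app (R : realType) (n m r : nat) (a : aexp R n m r)
    (f : seq bool -> bool) : aexp R n m r :=
  match a with
  | Const c => Const c
  | Abs s j y => Abs (stmt_app s f) j y
  end.

Definition rhs_app (R : realType) (n m r : nat) (e : rhs R n m r)
    (sg : strat_rhs e) : aexp R n m r :=
  aexp_app (tnth (in_tuple e) (tag sg)) (strat_fun (tagged sg)).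

Definition sys_app (R : realType) (n m r : nat) (E : system R n m r)
    (sg : strategy E) : system R n m r :=
  fun x => [:: rhs_app (sg x)].

(** * The strategy improvement algorithm *)

Definition improvement (R : realType) (n m r : nat) (T : 'M[R]_(m, n))
    (E : system R n m r) (rho : assignment R r) (sg sg' : strategy E) : Prop :=
  [/\ presolution T (sys_app sg) rho,
      ~ solution T E rho -> asg_lt rho (sys_val T (sys_app sg') rho) &
      forall x, sg' x != sg x ->
        (aexp_val T (rhs_app (sg x)) rho < aexp_val T (rhs_app (sg' x)) rho)%E].

Definition or_bot (R : realType) (n m r : nat) (E : system R n m r)
    : system R n m r :=
  fun x => rcons (E x) (Const -oo%E).

Lemma or_bot_last (R : realType) (n m r : nat) (E : system R n m r) (x : 'I_r) :
  (size (E x) < size (or_bot E x))%N.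
Proof. by rewrite size_rcons. Qed.

(* The strategy of [or_bot E] that selects the added disjunct everywhere. *)
Definition strat_init (R : realType) (n m r : nat) (E : system R n m r)
    : strategy (or_bot E) :=
  finfun (fun x : 'I_r =>
    Tagged (fun l => strat_aexp (tnth (in_tuple (or_bot E x)) l))
           ([ffun=> false] :
              strat_aexp (tnth (in_tuple (or_bot E x)) (Ordinal (or_bot_last E x))))).

Definition step (R : realType) (n m r : nat) (T : 'M[R]_(m, n))
    (E : system R n m r) (sg : strategy E) (rho : assignment R r)
    (sg' : strategy E) (rho' : assignment R r) : Prop :=
  [/\ ~ solution T E rho, improvement T rho sg sg' &
      least_solution_ge T (sys_app sg') rho rho'].

(* [run T E k sg rho]: after [k] steps the algorithm may be in state
   [(sg, rho)]. *)
Inductive run (R : realType) (n m r : nat) (T : 'M[R]_(m, n))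
    (E : system R n m r)
    : nat -> strategy (or_bot E) -> assignment R r -> Prop :=
| run_init : run T 0 (strat_init E) (fun=> -oo%E)
| run_step k sg rho sg' rho' :
    run T k sg rho -> step T sg rho sg' rho' -> run T k.+1 sg' rho'.

(** * SAT modulo real linear arithmetic *)

(* [(a, k)] stands for the sum of the [c * x_v] for [(c, v)] in [a], plus
   [k]. *)
Definition linexp (R : realType) : Type := (seq (R * nat) * R)%type.

(* Real variables and Boolean variables are numbered independently. *)
Inductive lra_formula (R : realType) : Type :=
| FTrue
| FBool of nat
| FLe of linexp R & linexp R
| FLt of linexp R & linexp R
| FNot of lra_formula R
| FAnd of lra_formula R & lra_formula R
| FOr of lra_formula R & lra_formula R.

Record valuation (R : realType) : Type :=
  Valuation { real_val : nat -> R; bool_val : nat -> bool }.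

Definition lin_val (R : realType) (xi : nat -> R) (t : linexp R) : R :=
  \sum_(cv <- t.1) cv.1 * xi cv.2 + t.2.

Fixpoint models (R : realType) (M : valuation R) (phi : lra_formula R) : bool :=
  match phi with
  | FTrue => true
  | FBool v => bool_val M v
  | FLe t u => lin_val (real_val M) t <= lin_val (real_val M) u
  | FLt t u => lin_val (real_val M) t < lin_val (real_val M) u
  | FNot p => ~~ models M p
  | FAnd p q => models M p && models M q
  | FOr p q => models M p || models M q
  end.

(* An answer of the solver: a model, or [None] if the formula is
   unsatisfiable. *)
Definition sat_answer (R : realType) (phi : lra_formula R) (ans : option (valuation R))
    : Prop :=
  match ans with
  | Some M => models M phi
  | None => forall M, ~~ models M phi
  end.

(* In the formula for a right-hand side, the choices are represented by the
   Boolean variables 0, 1, 2, ...: for each disjunct in turn, one variable for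
   the selection of this disjunct, then one variable for each of its choice
   positions.  Further Boolean variables may follow. *)
Definition select_var (R : realType) (n m r : nat) (e : rhs R n m r) (l : nat)
    : nat :=
  sumn [seq (size (aexp_pos a)).+1 | a <- take l e].

Definition pos_var (R : realType) (n m r : nat) (e : rhs R n m r)
    (l : 'I_(size e)) (p : seq bool) : nat :=
  (select_var e l).+1 + index p (aexp_pos (tnth (in_tuple e) l)).

Definition strat_of_bools (R : realType) (n m r : nat) (e : rhs R n m r)
    (b : nat -> bool) : option (strat_rhs e) :=
  omap (fun l : 'I_(size e) =>
          Tagged (fun l => strat_aexp (tnth (in_tuple e) l))
                 ([ffun p => b (pos_var l (val p))] :
                    strat_aexp (tnth (in_tuple e) l)))
       [pick l : 'I_(size e) | b (select_var e l)].

(* Where there is no model, the strategy is left as it is. *)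
Definition next_strategy (R : realType) (n m r : nat) (E : system R n m r)
    (sg : strategy E) (ans : 'I_r -> option (valuation R)) : strategy E :=
  finfun (fun x : 'I_r =>
    if ans x is Some M then odflt (sg x) (strat_of_bools (E x) (bool_val M))
    else sg x).

(** * Linear programming *)

(* The linear program sup {c x | x in R^N, A x <= b}, with the rows [c] and
   [A i] given sparsely: [(a, v)] adds [a] to the coefficient of [x_v]. *)
Record lp (R : realType) : Type := Lp {
  lp_dim : nat;
  lp_obj : seq (R * nat);
  lp_rows : seq (seq (R * nat) * R) }.

Definition sparse_row (R : realType) (N : nat) (a : seq (R * nat)) : 'rV[R]_N :=
  \row_(j < N) \sum_(cv <- a | cv.2 == j) cv.1.

Definition lp_c (R : realType) (L : lp R) : 'rV[R]_(lp_dim L) :=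
  sparse_row (lp_dim L) (lp_obj L).

Definition lp_A (R : realType) (L : lp R)
    : 'M[R]_(size (lp_rows L), lp_dim L) :=
  \matrix_i sparse_row (lp_dim L) (tnth (in_tuple (lp_rows L)) i).1.

Definition lp_b (R : realType) (L : lp R) : 'cV[R]_(size (lp_rows L)) :=
  \col_i (tnth (in_tuple (lp_rows L)) i).2.

Definition lp_feasible (R : realType) (L : lp R) (x : 'cV[R]_(lp_dim L)) : Prop :=
  forall i, (lp_A L *m x) i 0 <= lp_b L i 0.

Definition lp_optimal (R : realType) (L : lp R) (x : 'cV[R]_(lp_dim L)) : Prop :=
  lp_feasible x /\
  forall y, lp_feasible y -> (lp_c L *m y) 0 0 <= (lp_c L *m x) 0 0.

Definition coord (R : realType) (N : nat) (z : 'cV[R]_N) (k : nat) : R :=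
  if insub k is Some i then z i 0 else 0.

(* The variable [x] of the system is the variable number [x] of the linear
   program, unless the strategy selects the constant -oo for it. *)
Definition asg_of_lp (R : realType) (n m r : nat) (E : system R n m r)
    (sg : strategy E) (N : nat) (z : 'cV[R]_N) : assignment R r :=
  fun x => if rhs_app (sg x) is Const -oo%E then -oo%E else (coord z x)%:E.

(** * Linear-time constructions *)

(* Programs are first-order functional programs over binary trees whose leaves
   are natural numbers or real numbers.  Each evaluation step costs one time
   unit, and so do the operations on the leaves (unit-cost model over the
   reals).  A program is the list of the bodies of its one-argument functions;
   it is started by calling function 0. *)

Inductive tree (R : realType) : Type :=
| TNat of nat
| TReal of R
| TPair of tree R & tree R.

Arguments TNat {R}.

Fixpoint tree_size (R : realType) (v : tree R) : nat :=
  match v with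
  | TNat _ => 1
  | TReal _ => 1
  | TPair v w => (tree_size v + tree_size w).+1
  end.

(* [CVar i] is a de Bruijn index; [CNat k] and [CReal k] are the natural number
   and the real number [k]. *)
Inductive code : Type :=
| CVar of nat
| CLet of code & code
| CCall of nat & code
| CPair of code & code
| CFst of code
| CSnd of code
| CNat of nat
| CAddn of code & code
| CReal of nat
| CAdd of code & code
| COpp of code
| CMul of code & code
| CIfPair of code & code & code
| CIfEqn of code & code & code & code
| CIfLe of code & code & code & code.

Definition program : Type := seq code.

(* [eval P env c v t]: in the environment [env], the code [c] evaluates to [v]
   in time [t]. *)
Inductive eval (R : realType) (P : program)
    : seq (tree R) -> code -> tree R -> nat -> Prop :=
| eval_var env i v : onth env i = Some v -> eval P env (CVar i) v 1
| eval_let env c d v w t u :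
    eval P env c v t -> eval P (v :: env) d w u ->
    eval P env (CLet c d) w (t + u).+1
| eval_call env f b c v w t u :
    onth P f = Some b -> eval P env c v t -> eval P [:: v] b w u ->
    eval P env (CCall f c) w (t + u).+1
| eval_pair env c d v w t u :
    eval P env c v t -> eval P env d w u ->
    eval P env (CPair c d) (TPair v w) (t + u).+1
| eval_fst env c v w t :
    eval P env c (TPair v w) t -> eval P env (CFst c) v t.+1
| eval_snd env c v w t :
    eval P env c (TPair v w) t -> eval P env (CSnd c) w t.+1
| eval_nat env k : eval P env (CNat k) (TNat k) 1
| eval_addn env c d k l t u :
    eval P env c (TNat k) t -> eval P env d (TNat l) u ->
    eval P env (CAddn c d) (TNat (k + l)) (t + u).+1
| eval_real env k : eval P env (CReal k) (TReal k%:R) 1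
| eval_add env c d a b t u :
    eval P env c (TReal a) t -> eval P env d (TReal b) u ->
    eval P env (CAdd c d) (TReal (a + b)) (t + u).+1
| eval_opp env c a t :
    eval P env c (TReal a) t -> eval P env (COpp c) (TReal (- a)) t.+1
| eval_mul env c d a b t u :
    eval P env c (TReal a) t -> eval P env d (TReal b) u ->
    eval P env (CMul c d) (TReal (a * b)) (t + u).+1
| eval_ifpair env c d1 d2 v w t u :
    eval P env c v t ->
    eval P env (if v is TPair _ _ then d1 else d2) w u ->
    eval P env (CIfPair c d1 d2) w (t + u).+1
| eval_ifeqn env c1 c2 d1 d2 k l w t1 t2 u :
    eval P env c1 (TNat k) t1 -> eval P env c2 (TNat l) t2 ->
    eval P env (if (k == l)%N then d1 else d2) w u ->
    eval P env (CIfEqn c1 c2 d1 d2) w (t1 + t2 + u).+1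
| eval_ifle env c1 c2 d1 d2 a b w t1 t2 u :
    eval P env c1 (TReal a) t1 -> eval P env c2 (TReal b) t2 ->
    eval P env (if a <= b then d1 else d2) w u ->
    eval P env (CIfLe c1 c2 d1 d2) w (t1 + t2 + u).+1.

(* [P] turns the input [v] into [w] in time at most [C] times the size of
   [v]. *)
Definition constructs (R : realType) (P : program) (C : nat) (v w : tree R)
    : Prop :=
  exists2 t, eval P [:: v] (CCall 0 (CVar 0)) w t & (t <= C * tree_size v)%N.

Fixpoint enc_seq (R : realType) (s : seq (tree R)) : tree R :=
  if s is v :: s' then TPair v (enc_seq s') else TNat 0.

Definition enc_ereal (R : realType) (c : \bar R) : tree R :=
  match c with
  | a%:E => TPair (TNat 0) (TReal a)
  | +oo%E => TNat 0
  | -oo%E => TNat 1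
  end.

Definition enc_cV (R : realType) (k : nat) (b : 'cV[R]_k) : tree R :=
  enc_seq [seq TReal (b i 0) | i <- enum 'I_k].

(* The rows are preceded by the list of the column indices, so that the number
   of columns is apparent even if there are no rows. *)
Definition enc_mx (R : realType) (k n : nat) (A : 'M[R]_(k, n)) : tree R :=
  TPair (enc_seq [seq TNat (val j) | j <- enum 'I_n])
        (enc_seq [seq enc_seq [seq TReal (A i j) | j <- enum 'I_n] | i <- enum 'I_k]).

Fixpoint enc_stmt (R : realType) (n : nat) (s : stmt R n) : tree R :=
  match s with
  | Assign A b => TPair (TNat 0) (TPair (enc_mx A) (enc_cV b))
  | Guard k A b => TPair (TNat 1) (TPair (enc_mx A) (enc_cV b))
  | Seq s0 s1 => TPair (TNat 2) (TPair (enc_stmt s0) (enc_stmt s1))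
  | Choice s0 s1 => TPair (TNat 3) (TPair (enc_stmt s0) (enc_stmt s1))
  end.

(* The abstract transformer is determined by the statement and the template,
   and is written down as these two. *)
Definition enc_aexp (R : realType) (n m r : nat) (T : 'M[R]_(m, n))
    (a : aexp R n m r) : tree R :=
  match a with
  | Const c => TPair (TNat 0) (enc_ereal c)
  | Abs s j y =>
      TPair (TNat 1)
        (TPair (TPair (enc_stmt s) (enc_mx T))
           (TPair (TNat (val j))
              (enc_seq [seq TNat (val (y i)) | i <- enum 'I_m])))
  end.

Definition enc_system (R : realType) (n m r : nat) (T : 'M[R]_(m, n))
    (E : system R n m r) : tree R :=
  enc_seq [seq enc_seq [seq enc_aexp T a | a <- E x] | x <- enum 'I_r].

Definition enc_asg (R : realType) (r : nat) (rho : assignment R r) : tree R :=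
  enc_seq [seq enc_ereal (rho x) | x <- enum 'I_r].

Fixpoint enc_strat_stmt (R : realType) (n : nat) (s : stmt R n)
    (f : seq bool -> bool) : tree R :=
  match s with
  | Assign _ _ => TNat 0
  | Guard _ _ _ => TNat 0
  | Seq s0 s1 =>
      TPair (enc_strat_stmt s0 (fun p => f (false :: p)))
            (enc_strat_stmt s1 (fun p => f (true :: p)))
  | Choice s0 s1 =>
      TPair (TNat (nat_of_bool (f [::])))
        (TPair (enc_strat_stmt s0 (fun p => f (false :: p)))
               (enc_strat_stmt s1 (fun p => f (true :: p))))
  end.

Definition enc_strat_aexp (R : realType) (n m r : nat) (a : aexp R n m r)
    (f : seq bool -> bool) : tree R :=
  match a with
  | Const _ => TNat 0
  | Abs s _ _ => enc_strat_stmt s f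
  end.

Definition enc_strategy (R : realType) (n m r : nat) (E : system R n m r)
    (sg : strategy E) : tree R :=
  enc_seq
    [seq TPair (TNat (val (tag (sg x))))
               (enc_strat_aexp (tnth (in_tuple (E x)) (tag (sg x)))
                  (strat_fun (tagged (sg x))))
    | x <- enum 'I_r].

Definition enc_terms (R : realType) (a : seq (R * nat)) : tree R :=
  enc_seq [seq TPair (TReal cv.1) (TNat cv.2) | cv <- a].

Definition enc_linexp (R : realType) (t : linexp R) : tree R :=
  TPair (enc_terms t.1) (TReal t.2).

Fixpoint enc_formula (R : realType) (phi : lra_formula R) : tree R :=
  match phi with
  | FTrue => TNat 0
  | FBool v => TPair (TNat 0) (TNat v)
  | FLe t u => TPair (TNat 1) (TPair (enc_linexp t) (enc_linexp u))
  | FLt t u => TPair (TNat 2) (TPair (enc_linexp t) (enc_linexp u))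
  | FNot p => TPair (TNat 3) (enc_formula p)
  | FAnd p q => TPair (TNat 4) (TPair (enc_formula p) (enc_formula q))
  | FOr p q => TPair (TNat 5) (TPair (enc_formula p) (enc_formula q))
  end.

Definition enc_lp (R : realType) (L : lp R) : tree R :=
  TPair (TNat (lp_dim L))
    (TPair (enc_terms (lp_obj L))
       (enc_seq [seq TPair (enc_terms row.1) (TReal row.2) | row <- lp_rows L])).

Definition sat_input (R : realType) (n m r : nat) (T : 'M[R]_(m, n))
    (E : system R n m r) (rho : assignment R r) (x : 'I_r) : tree R :=
  TPair (enc_system T E) (TPair (enc_asg rho) (TNat (val x))).

Definition lp_input (R : realType) (n m r : nat) (T : 'M[R]_(m, n))
    (E : system R n m r) (rho : assignment R r) (sg : strategy E) : tree R :=
  TPair (enc_system T E) (TPair (enc_asg rho) (enc_strategy sg)).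

(* Main.v *)
(* Under a strategy every equation is monotone and concave, being the value of a
   linear program in its arguments.  By concavity an extra invariant of the runs
   ("stable" below) is preserved by improvement steps; it implies that the
   current rho is the greatest presolution of the current sequential system that
   is finite where rho is.  Hence rho is determined by the strategy, and it is
   the optimum of a linear program; the optimum is attained because a linear
   image of a polyhedron is closed (Fourier-Motzkin elimination).

   For the number of steps, note that the equations of the variables with value
   above -oo only mention such variables, and that a variable never returns to
   -oo.  A step that raises no variable from -oo replaces the strategy on the
   finite variables, and since rho strictly increases, no later strategy agrees
   with the old one there.  So the strategies of E extending the old ones are
   pairwise distinct; there are at most |Sigma| such steps, and at most |X|
   steps of the other kind. *)

Require Import Defs.
From mathcomp Require Import all_boot all_order all_algebra.
From mathcomp Require Import all_classical all_reals.
From mathcomp Require Import ereal.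
From mathcomp Require Import ring lra zify.

Set Implicit Arguments.
Unset Strict Implicit.
Unset Printing Implicit Defensive.
Import Order.TTheory GRing.Theory Num.Theory.
Local Open Scope classical_set_scope.
Local Open Scope ring_scope.

(** * Limits of polyhedra *)

Section LinearSystems.
Variable R : realType.

(** The linear program maximizes over presolutions, whereas a step takes the least solution above
    [rho]; larger presolutions exist in general, and only [stable] rules them out. Concavity enters
    there by reflection: a presolution [nu] beyond [w] is mirrored at [w] to a point below [w],
    which yields a post-solution contradicting leastness. Values are suprema, possibly infinite, so
    the choice of a strategy is tied to strict lower bounds [c < ...], which always have a witness.
    Solvers only know real numbers: a value [-oo] needs a flag variable in the SAT formula and stays
    out of the objective of the linear program. Linear time rests on three facts: choices are
    guarded by Boolean variables instead of being expanded, rows are prepended to an accumulator,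
    and each abstract expression is encoded with its own copy of the template, to which its template
    rows are charged. *)

Lemma between_finite (L U : seq R) :
  (forall l u, l \in L -> u \in U -> l <= u) ->
  exists s, (forall l, l \in L -> l <= s) /\ (forall u, u \in U -> s <= u).
Proof.
elim: L => [|x L IH] LU.
  exists (- \sum_(u <- U) `|u|); split=> // u uU.
  rewrite (big_rem u uU) /= opprD.
  have : 0 <= \sum_(y <- rem u U) `|y| by apply: sumr_ge0.
  have := ler_norm (- u); rewrite normrN; lra.
have [|s [Ls sU]] := IH.
  by move=> l u lL uU; apply: LU; rewrite // inE lL orbT.
exists (Num.max x s); split.
  move=> l; rewrite inE le_max => /orP[/eqP->|/Ls ->]; first by rewrite lexx.
  by rewrite orbT.
by move=> u uU; rewrite ge_max sU // LU // inE eqxx.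
Qed.

(* The row [(a, (b, c))] stands for the inequality [a z <= b + eps c]. *)
Definition prow_sat (N : nat) (eps : R) (z : nat -> R)
    (p : (nat -> R) * (R * R)) : bool :=
  \sum_(i < N) p.1 i * z i <= p.2.1 + eps * p.2.2.

(* Fourier-Motzkin elimination of the last variable; the right-hand sides stay
   affine in [eps]. *)
Lemma FM_elim (N : nat) (l : seq ((nat -> R) * (R * R))) :
  exists l' : seq ((nat -> R) * (R * R)), forall eps,
    (exists z, all (prow_sat N.+1 eps z) l) <->
    (exists z, all (prow_sat N eps z) l').
Proof.
(* For [p.1 N > 0 > q.1 N] the multipliers [p.1 N] and [- q.1 N] are positive and cancel variable
   [N]. They do not involve [eps], so one list serves every [eps]. *)
pose comb (p q : (nat -> R) * (R * R)) : (nat -> R) * (R * R) :=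
  ((fun i => p.1 N * q.1 i - q.1 N * p.1 i),
   (p.1 N * q.2.1 - q.1 N * p.2.1, p.1 N * q.2.2 - q.1 N * p.2.2)).
pose lp := [seq p <- l | 0 < p.1 N]; pose ln := [seq p <- l | p.1 N < 0].
pose l0 := [seq p <- l | p.1 N == 0].
exists (l0 ++ [seq comb p q | p <- lp, q <- ln]) => eps.
have comb_sum p q z : \sum_(i < N) (comb p q).1 i * z i =
    p.1 N * (\sum_(i < N) q.1 i * z i) - q.1 N * (\sum_(i < N) p.1 i * z i).
  rewrite !mulr_sumr -sumrB; apply: eq_bigr => i _ /=; ring.
pose S z (p : (nat -> R) * (R * R)) := \sum_(i < N) p.1 i * z i.
split=> -[z /allP zl].
  have {}zl p : p \in l -> S z p + p.1 N * z N <= p.2.1 + eps * p.2.2.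
    by move=> /zl; rewrite /prow_sat big_ord_recr.
  exists z; rewrite all_cat; apply/andP; split; apply/allP.
    move=> p; rewrite mem_filter => /andP[/eqP p0 /zl].
    by rewrite p0 mul0r addr0.
  move=> _ /allpairsP[[p q] /= [+ + ->]]; rewrite !mem_filter.
  move=> /andP[p0 /zl Hp] /andP[q0 /zl Hq].
  rewrite /prow_sat comb_sum /= -!/(S _ _); nra.
pose bnd p := (p.2.1 + eps * p.2.2 - S z p) / p.1 N.
have bndP p q : 0 < p.1 N -> q.1 N < 0 -> prow_sat N eps z (comb p q) ->
    bnd q <= bnd p.
  move=> p0 q0; rewrite /prow_sat comb_sum /= /bnd -!/(S _ _) => H.
  rewrite ler_pdivlMr // mulrAC ler_ndivrMr //; nra.
have [|s [sl su]] :=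
    @between_finite [seq bnd q | q <- ln] [seq bnd p | p <- lp].
  move=> _ _ /mapP[q qn ->] /mapP[p pp ->].
  move: (qn) (pp); rewrite !mem_filter => /andP[q0 _] /andP[p0 _].
  apply: bndP => //; apply: zl; rewrite mem_cat; apply/orP; right.
  by apply/allpairsP; exists (p, q).
exists (fun i => if i == N then s else z i); apply/allP => p pl.
rewrite /prow_sat big_ord_recr /= eqxx.
under eq_bigr => i _ do rewrite ltn_eqF //.
rewrite -/(S z p); have [p0|p0|p0] := ltrgtP (p.1 N) 0.
- have : bnd p <= s by apply/sl/map_f; rewrite mem_filter p0.
  rewrite /bnd ler_ndivrMr //; lra.
- have : s <= bnd p by apply/su/map_f; rewrite mem_filter p0.
  rewrite /bnd ler_pdivlMr //; lra.
- rewrite p0 mul0r addr0; apply: zl.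
  by rewrite mem_cat mem_filter p0 eqxx pl.
Qed.

Lemma polyhedron_limit (N : nat) (l : seq ((nat -> R) * (R * R))) :
  (forall eps, 0 < eps -> exists z, all (prow_sat N eps z) l) ->
  exists z, all (prow_sat N 0 z) l.
Proof.
elim: N l => [|N IH] l H.
  exists (fun=> 0).
  have {}H eps : 0 < eps -> all (prow_sat 0 eps (fun=> 0)) l.
    move=> /H[z]; apply: sub_all => p; by rewrite /prow_sat !big_ord0.
  elim: l H => //= p l IH H; rewrite IH ?andbT; last by move=> e /H /andP[].
  rewrite /prow_sat big_ord0 mul0r addr0 leNgt; apply/negP => p0.
  (* This [e] makes [e * |p.2.2|] smaller than half of [- p.2.1], so the right-hand side stays
     negative. *)
  pose e := - p.2.1 / (2 * (`|p.2.2| + 1)).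
  have n0 : 0 < 2 * (`|p.2.2| + 1) by have := normr_ge0 p.2.2; lra.
  have e0 : 0 < e by rewrite divr_gt0 // oppr_gt0.
  have /H/andP[] := e0; rewrite /prow_sat big_ord0 => He _.
  have : e * (2 * (`|p.2.2| + 1)) = - p.2.1 by rewrite divfK // gt_eqF.
  have := ler_norm p.2.2; nra.
have [l' Hl'] := FM_elim N l.
by apply/Hl'/IH => eps /H /Hl'.
Qed.

End LinearSystems.

(** * Sequential statements *)

Section Semantics.
Variables (R : realType) (n : nat).
Implicit Types (s : stmt R n) (X Y : set 'cV[R]_n).

Lemma sem_mono s X Y : X `<=` Y -> sem s X `<=` sem s Y.
Proof.
elim: s X Y => [A b|k A b|s0 IH0 s1 IH1|s0 IH0 s1 IH1] X Y XY z /=.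
- by case=> x Xx <-; exists x => //; apply: XY.
- by case=> Xz ?; split=> //; apply: XY.
- by apply: IH1; apply: IH0.
- by case=> [/(IH0 _ _ XY)|/(IH1 _ _ XY)]; [left|right].
Qed.

Lemma sem_point s X z : sem s X z <-> exists2 x, X x & sem s [set x] z.
Proof.
split; last by case=> x Xx; apply: sem_mono => _ ->.
elim: s X z => [A b|k A b|s0 IH0 s1 IH1|s0 IH0 s1 IH1] X z /=.
- by case=> x Xx <-; exists x => //; exists x.
- by case=> Xz ?; exists z.
- case/IH1 => y /IH0[x Xx xy] yz; exists x => //.
  by apply: sem_mono yz => _ ->.
- by case=> [/IH0|/IH1] [x Xx xz]; exists x => //; [left|right].
Qed.

Lemma sem_stmt_app s X z : sem s X z <-> exists g, sem (stmt_app s g) X z.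
Proof.
elim: s X z => [A b|k A b|s0 IH0 s1 IH1|s0 IH0 s1 IH1] X z /=.
- by split=> [H|[]//]; exists xpred0.
- by split=> [H|[]//]; exists xpred0.
- split.
    case/IH1=> g1; rewrite sem_point => -[y /IH0[g0 xy] yz].
    (* The strategies of the two halves of the run through [y] merge, since positions in different
       operands start with different Booleans. *)
    exists (fun p => if p is d :: q then (if d then g1 q else g0 q) else false).
    by rewrite sem_point; exists y.
  case=> g zs; apply/IH1; exists (fun p => g (true :: p)).
  by apply: sem_mono zs => y ys; apply/IH0; exists (fun p => g (false :: p)).
- split.
    case=> [/IH0[g H]|/IH1[g H]].
      by exists (fun p => if p is d :: q then g q else false).
    by exists (fun p => if p is d :: q then g q else true).
  case=> g; case: ifP => _ H; [right; apply/IH1|left; apply/IH0];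
    by eexists; apply: H.
Qed.

Lemma stmt_app_ext s (f g : seq bool -> bool) :
  {in choice_pos s, f =1 g} -> stmt_app s f = stmt_app s g.
Proof.
elim: s f g => [//|//|s0 IH0 s1 IH1|s0 IH0 s1 IH1] f g fg /=.
  congr Seq; [apply: IH0|apply: IH1] => p pP; apply: fg; rewrite mem_cat.
    by rewrite map_f.
  by rewrite map_f // orbT.
rewrite fg ?inE ?eqxx //; case: ifP => _; [apply: IH1|apply: IH0] => p pP;
  by apply: fg; rewrite inE mem_cat map_f ?orbT.
Qed.

(* A sequential statement is one affine guard followed by one affine
   assignment. *)
Lemma sem_stmt_app_affine s (g : seq bool -> bool) :
  exists (A : 'M[R]_n) (b : 'cV[R]_n) (l : seq ('rV[R]_n * R)), forall X z,
    sem (stmt_app s g) X z <->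
    exists x, [/\ X x, all (fun c => (c.1 *m x) 0 0 <= c.2) l & z = A *m x + b].
Proof.
elim: s g => [A b|k A b|s0 IH0 s1 IH1|s0 IH0 s1 IH1] g /=.
- exists A, b, [::] => X z; split=> [[x Xx <-]|[x [Xx _ ->]]]; by exists x.
- exists 1%:M, 0, [seq (row i A, b i 0) | i <- enum 'I_k] => X z.
  have E x : all (fun c => (c.1 *m x) 0 0 <= c.2)
      [seq (row i A, b i 0) | i <- enum 'I_k] <->
      (forall i, (A *m x) i 0 <= b i 0).
    rewrite all_map; split=> [/allP H i|H]; last first.
      by apply/allP => i _ /=; rewrite -row_mul mxE.
    by have := H i (mem_enum _ _); rewrite /= -row_mul mxE.
  split=> [[Xz zA]|[x [Xx /E xA ->]]]; last by rewrite mul1mx addr0; split.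
  by exists z; rewrite mul1mx addr0; split => //; apply/E.
- have [A0 [b0 [l0 H0]]] := IH0 (fun p => g (false :: p)).
  have [A1 [b1 [l1 H1]]] := IH1 (fun p => g (true :: p)).
  (* The guards of the second statement are pulled back along the assignment of the first. *)
  exists (A1 *m A0), (A1 *m b0 + b1),
    (l0 ++ [seq (c.1 *m A0, c.2 - (c.1 *m b0) 0 0) | c <- l1]) => X z.
  have E x : all (fun c => (c.1 *m x) 0 0 <= c.2)
      [seq (c.1 *m A0, c.2 - (c.1 *m b0) 0 0) | c <- l1] =
      all (fun c => (c.1 *m (A0 *m x + b0)) 0 0 <= c.2) l1.
    rewrite all_map; apply: eq_all => c /=.
    by rewrite mulmxDr mulmxA [in RHS]mxE lerBrDr.
  split.
    case/H1=> y [/H0[x [Xx x0 ->]] y1 ->]; exists x.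
    by rewrite all_cat x0 E y1 mulmxDr !mulmxA addrA.
  case=> x [Xx]; rewrite all_cat E => /andP[x0 x1] ->; apply/H1.
  exists (A0 *m x + b0); split=> //; last by rewrite mulmxDr !mulmxA addrA.
  by apply/H0; exists x.
- by case: ifP.
Qed.

End Semantics.

(** * Abstract transformers: monotonicity, concavity, attainment of the supremum *)

Section Abstract.
Variables (R : realType) (n m r : nat) (T : 'M[R]_(m, n)).

(** The vector of these suprema is itself an admissible [d], so the infimum is attained at it. *)
Lemma alphaE (X : set 'cV[R]_n) j :
  alpha T X j = ereal_sup [set ((T *m z) j 0)%:E | z in X].
Proof.
apply/eqP; rewrite eq_le; apply/andP; split.
  apply: ereal_inf_lbound => /=.
  exists (fun j => ereal_sup [set ((T *m z) j 0)%:E | z in X]) => //= z Xz i.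
  by apply: ereal_sup_ubound; exists z.
apply: le_ereal_inf_tmp => _ [d Xd <-]; apply: ge_ereal_sup => _ [z Xz <-].
exact: Xd.
Qed.

Lemma aexp_val_mono (a : aexp R n m r) (rho nu : assignment R r) :
  asg_le rho nu -> (aexp_val T a rho <= aexp_val T a nu)%E.
Proof.
move=> le; case: a => [c|s j y] //=; rewrite /abs_sem !alphaE.
apply: ereal_sup_le => _ [z zX <-]; exists z => //; apply: sem_mono zX => x xX i.
exact: le_trans (xX i) (le _).
Qed.

(* A variable with value [-oo] makes the concretization empty. *)
Lemma aexp_val_arg (s : stmt R n) j (y : 'I_m -> 'I_r) (rho : assignment R r) :
  (-oo < aexp_val T (Abs s j y) rho)%E -> forall i, (-oo < rho (y i))%E.
Proof.
rewrite /= /abs_sem alphaE => /ereal_sup_gt[_ [z /sem_point[x xX _] _] _] i.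
by apply: lt_le_trans (xX i); rewrite ltNyr.
Qed.

(** A strict lower bound of a supremum is witnessed by one output point, and that point is reached
    under one strategy. *)
Lemma aexp_app_gt (a : aexp R n m r) (rho : assignment R r) (c : \bar R) :
  (c < aexp_val T a rho)%E <->
  exists g, (c < aexp_val T (aexp_app a g) rho)%E.
Proof.
case: a => [d|s j y] /=; first by split=> [|[]//]; exists xpred0.
rewrite /abs_sem !alphaE; split.
  move=> /ereal_sup_gt[_ [z /sem_stmt_app[g zg] <-] cz]; exists g.
  rewrite alphaE; apply: lt_le_trans cz _; apply: ereal_sup_ubound.
  by exists z.
case=> g; rewrite alphaE => /ereal_sup_gt[_ [z zg <-] cz].
apply: lt_le_trans cz _; apply: ereal_sup_ubound; exists z => //.
by apply/sem_stmt_app; exists g.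
Qed.

Definition asg_real (a : 'I_r -> R) : assignment R r := fun x => (a x)%:E.

(** A convex combination of runs for [u] and for [v] is a run for the combined arguments, because
    all constraints are affine. The form through points [p], [q] of the hypograph avoids arithmetic
    with infinite values. *)
Lemma aexp_app_concave (a : aexp R n m r) g (u v : 'I_r -> R) (p q t : R) :
  0 <= t <= 1 ->
  (p%:E <= aexp_val T (aexp_app a g) (asg_real u))%E ->
  (q%:E <= aexp_val T (aexp_app a g) (asg_real v))%E ->
  (((1 - t) * p + t * q)%:E
    <= aexp_val T (aexp_app a g)
         (asg_real (fun x => (1 - t) * u x + t * v x)%R))%E.
Proof.
case/andP=> t0 t1; case: a => [[c| |]|s j y] //=.
- by rewrite !lee_fin; nra.
- by move=> *; rewrite leey.
rewrite /abs_sem !alphaE.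
have [A [b [l H]]] := sem_stmt_app_affine s g.
(* The slack [e] allows runs that are only almost optimal. *)
move=> pu qv; apply/lee_addgt0Pr => e e0.
have /ereal_sup_gt[_ [_ /H[x [xX xl ->]] <-] px] :
    ((p - e)%:E < ereal_sup [set ((T *m z) j 0)%:E
      | z in sem (stmt_app s g) (gamma T (fun i => asg_real u (y i)))])%E.
  by apply: lt_le_trans pu; rewrite lte_fin; lra.
have /ereal_sup_gt[_ [_ /H[x' [xX' xl' ->]] <-] qx'] :
    ((q - e)%:E < ereal_sup [set ((T *m z) j 0)%:E
      | z in sem (stmt_app s g) (gamma T (fun i => asg_real v (y i)))])%E.
  by apply: lt_le_trans qv; rewrite lte_fin; lra.
rewrite !lte_fin in px qx'.
pose w := (1 - t) *: x + t *: x'.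
have W k (B : 'M[R]_(k, n)) i : (B *m w) i 0 =
    (1 - t) * (B *m x) i 0 + t * (B *m x') i 0.
  by rewrite mulmxDr -!scalemxAr !mxE.
rewrite -leeBlDr //; apply: le_trans (ereal_sup_ubound _).
2:{ exists (A *m w + b); last by [].
    apply/H; exists w; split=> //.
      move=> i; rewrite W lee_fin.
      by have := xX i; have := xX' i; rewrite !lee_fin; nra.
    elim: (l) xl xl' => //= c l' IH /andP[cx xl] /andP[cx' xl'].
    by rewrite IH // andbT W; nra. }
have E k : (T *m (A *m k + b)) j 0 = (T *m A *m k) j 0 + (T *m b) j 0.
  by rewrite mulmxDr mulmxA mxE.
by move: px qx'; rewrite -EFinB lee_fin !E W; nra.
Qed.

Lemma aexp_app_attained s g j (y : 'I_m -> 'I_r) (rho : assignment R r) (c : R) :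
  (forall i, (rho (y i) < +oo)%E) ->
  aexp_val T (Abs (stmt_app s g) j y) rho = c%:E ->
  exists2 z, sem (stmt_app s g) (gamma T (fun i => rho (y i))) z &
    c <= (T *m z) j 0.
Proof.
move=> fin vc.
have /aexp_val_arg gt : (-oo < aexp_val T (Abs (stmt_app s g) j y) rho)%E.
  by rewrite vc ltNyr.
have re i : rho (y i) = (fine (rho (y i)))%:E.
  by rewrite fineK // fin_numE -ltey -ltNye gt fin.
move: vc; rewrite /= /abs_sem alphaE.
have [A [b [l H]]] := sem_stmt_app_affine s g => vc.
pose f (a : 'rV[R]_n) k : R := if insub k is Some i then a 0 i else 0.
have fE (a : 'rV[R]_n) (z : nat -> R) :
    \sum_(i < n) f a i * z i = (a *m (\col_(i < n) z i)) 0 0.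
  by rewrite mxE; apply: eq_bigr => i _; rewrite /f valK !mxE.
(* Template constraints, guards, and a last row asking for a value of at least [c - eps]; only the
   last one depends on [eps]. *)
pose rows : seq ((nat -> R) * (R * R)) :=
  [seq (f (row i T), (fine (rho (y i)), 0)) | i <- enum 'I_m] ++
  [seq (f d.1, (d.2, 0)) | d <- l] ++
  [:: (f (- row j (T *m A)), ((T *m b) j 0 - c, 1))].
have rowsP eps (z : nat -> R) (x := \col_(i < n) z i) :
    all (prow_sat n eps z) rows <->
    [/\ gamma T (fun i => rho (y i)) x, all (fun d => (d.1 *m x) 0 0 <= d.2) l
      & c - eps <= (T *m (A *m x + b)) j 0].
  rewrite !all_cat /= andbT [all _ [seq _ | _ <- l]]all_map.
  have -> : all (preim (fun d => (f d.1, (d.2, 0))) (prow_sat n eps z)) l =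
      all (fun d => (d.1 *m x) 0 0 <= d.2) l.
    by apply: eq_all => d; rewrite /= /prow_sat fE mulr0 addr0.
  have -> : prow_sat n eps z (f (- row j (T *m A)), ((T *m b) j 0 - c, 1)) =
      (c - eps <= (T *m (A *m x + b)) j 0).
    rewrite /prow_sat fE /= mulNmx -row_mul mulmxDr mulmxA !mxE.
    by apply/idP/idP; lra.
  have gE : all (prow_sat n eps z)
      [seq (f (row i T), (fine (rho (y i)), 0)) | i <- enum 'I_m] <->
      gamma T (fun i => rho (y i)) x.
    have E i : prow_sat n eps z (f (row i T), (fine (rho (y i)), 0)) =
        (((T *m x) i 0)%:E <= rho (y i))%E.
      by rewrite /prow_sat fE -row_mul mxE mulr0 addr0 -lee_fin -re.
    rewrite all_map; split=> [/allP Hi i|Hi]; last first.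
      by apply/allP => i _ /=; rewrite E.
    by rewrite -E; apply: Hi; rewrite mem_enum.
  split=> [/and3P[Hg -> ->]|[Hg -> ->]]; first by split=> //; apply: (proj1 gE).
  by rewrite (proj2 gE Hg).
have [eps eps0|z /rowsP[gz lz cz]] := @polyhedron_limit _ n rows.
  have /ereal_sup_gt[_ [_ /H[x [xX xl ->]] <-] cx] :
      ((c - eps)%:E < ereal_sup [set ((T *m z) j 0)%:E
        | z in sem (stmt_app s g) (gamma T (fun i => rho (y i)))])%E.
    by rewrite vc lte_fin; lra.
  exists (fun k => if insub k is Some i then x i 0 else 0); apply/rowsP.
  have -> : \col_(i < n) (if insub (val i) is Some i then x i 0 else 0) = x.
    by apply/colP => i; rewrite mxE valK.
  by split=> //; rewrite lte_fin in cx; apply: ltW.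
exists (A *m (\col_(i < n) z i) + b); last by move: cz; rewrite subr0.
by apply/H; exists (\col_(i < n) z i).
Qed.

End Abstract.

(** * Improvement steps *)

Section Systems.
Variables (R : realType) (n m r : nat) (T : 'M[R]_(m, n)).
Implicit Types (S : system R n m r) (rho nu : assignment R r) (e : rhs R n m r).

Lemma rhs_val_mono e rho nu : asg_le rho nu -> (rhs_val T e rho <= rhs_val T e nu)%E.
Proof.
move=> le; rewrite /rhs_val.
elim/big_ind2: _ => [//|a b c d ab cd|a _]; last exact: aexp_val_mono.
by rewrite ge_max !le_max ab cd orbT.
Qed.

(** Knaster-Tarski above [rho]. Minimality among all post-solutions is recorded too, since later
    arguments exhibit post-solutions that are not solutions. *)
Lemma least_solution_ge_exists S rho : presolution T S rho ->
  exists2 mu, least_solution_ge T S rho mu &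
    forall nu, asg_le (sys_val T S nu) nu -> asg_le rho nu -> asg_le mu nu.
Proof.
move=> pre.
pose post : set (assignment R r) :=
  [set nu | asg_le (sys_val T S nu) nu /\ asg_le rho nu].
pose mu : assignment R r := fun x => ereal_inf [set nu x | nu in post].
have mu_le nu : post nu -> asg_le mu nu.
  by move=> postnu x; apply: ereal_inf_lbound; exists nu.
have le_mu : asg_le rho mu.
  by move=> x; apply: le_ereal_inf_tmp => _ [nu [_ +] <-]; apply.
have Smu : asg_le (sys_val T S mu) mu.
  move=> x; apply: le_ereal_inf_tmp => _ [nu postnu <-].
  apply: le_trans (proj1 postnu x).
  exact: rhs_val_mono (mu_le _ postnu).
have muS : asg_le mu (sys_val T S mu).
  apply: mu_le; split=> x; first exact: rhs_val_mono.
  apply: le_trans (pre x) _; exact: rhs_val_mono.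
exists mu; last by move=> nu ? ?; apply: mu_le.
split=> //; first by apply/funext => x; apply/eqP; rewrite eq_le muS Smu.
by move=> nu sol le; apply: mu_le; split=> // x; rewrite {2}sol.
Qed.

Lemma least_solution_ge_post S rho mu nu :
  presolution T S rho -> least_solution_ge T S rho mu ->
  asg_le (sys_val T S nu) nu -> asg_le rho nu -> asg_le mu nu.
Proof.
move=> /least_solution_ge_exists[mu' [sol' ge' _] le'] [_ _ le] post ge x.
exact: le_trans (le _ sol' ge' x) (le' _ post ge x).
Qed.

Lemma sys_val_app S (sg : strategy S) rho x :
  sys_val T (sys_app sg) rho x = aexp_val T (rhs_app (sg x)) rho.
Proof. by rewrite /sys_val /rhs_val big_seq1. Qed.

Lemma rhs_val_gt e rho c :
  (c < rhs_val T e rho)%E <->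
  exists l, (c < aexp_val T (tnth (in_tuple e) l) rho)%E.
Proof.
rewrite /rhs_val (big_tnth _ _ e); split.
  case: (pselect (exists l, (c < aexp_val T (tnth (in_tuple e) l) rho)%E)) => //.
  move=> H /=; suff : (\big[maxe/-oo]_(i < size e)
      aexp_val T (tnth (in_tuple e) i) rho <= c)%E by rewrite leNgt => /negP.
  elim/big_ind: _ => [|a b ac bc|l _]; first by rewrite leNye.
    by rewrite ge_max ac bc.
  by rewrite leNgt; apply/negP => cl; apply: H; exists l.
case=> l cl; apply: lt_le_trans cl _.
by rewrite (bigD1 l) //= le_max lexx.
Qed.

(** Only the positions of [a] are ever inspected, so [g] may be restricted to them. *)
Lemma aexp_app_strat (a : aexp R n m r) (g : seq bool -> bool) :
  aexp_app a (strat_fun ([ffun p => g (val p)] : strat_aexp a)) = aexp_app a g.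
Proof.
case: a => //= s j y; congr Abs; apply: stmt_app_ext => p pP.
by rewrite /strat_fun /= insubT /= ffunE.
Qed.

Lemma rhs_app_gt e rho c :
  (c < rhs_val T e rho)%E <->
  exists sg : strat_rhs e, (c < aexp_val T (rhs_app sg) rho)%E.
Proof.
rewrite rhs_val_gt; split=> -[].
  move=> l /aexp_app_gt[g cg].
  exists (Tagged (fun l => strat_aexp (tnth (in_tuple e) l))
    ([ffun p => g (val p)] : strat_aexp (tnth (in_tuple e) l))).
  by rewrite /rhs_app /= aexp_app_strat.
by move=> sg cg; exists (tag sg); apply/aexp_app_gt; eexists; apply: cg.
Qed.

Lemma rhs_app_le e rho (sg : strat_rhs e) :
  (aexp_val T (rhs_app sg) rho <= rhs_val T e rho)%E.
Proof.
rewrite leNgt; apply/negP => lt.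
suff : (rhs_val T e rho < rhs_val T e rho)%E by rewrite ltxx.
by apply/rhs_app_gt; exists sg.
Qed.

Lemma sys_val_or_bot S : sys_val T (or_bot S) = sys_val T S.
Proof.
apply/funext => rho; apply/funext => x.
rewrite /sys_val /or_bot /rhs_val -cats1 big_cat big_seq1 /=.
by apply/max_idPl; rewrite leNye.
Qed.

Lemma solution_or_bot S rho : solution T (or_bot S) rho <-> solution T S rho.
Proof. by rewrite /solution sys_val_or_bot. Qed.

Lemma rhs_app_init S x : rhs_app (strat_init S x) = Const -oo%E.
Proof.
rewrite /strat_init ffunE /rhs_app /=.
set a := tnth _ _; suff -> : a = Const -oo%E by [].
by rewrite /a (tnth_nth (Const 0%E)) /= nth_rcons ltnn eqxx.
Qed.

End Systems.

(** * Preservation of the invariant and length of the runs *)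

Section Iteration.
Variables (R : realType) (n m r : nat) (T : 'M[R]_(m, n)).
Variables (E : system R n m r) (mu : assignment R r).
Hypotheses (mu_sol : solution T E mu) (mu_fin : forall x, (mu x < +oo)%E).
Implicit Types (sg : strategy (or_bot E)) (rho : assignment R r).

Local Notation val_at sg rho x := (aexp_val T (rhs_app (sg x)) rho).

(* The last condition strengthens "rho is the greatest finite presolution" so
   that it is preserved by improvement steps: [w] coincides with [rho] on [D],
   is strictly greater elsewhere, and the equations in [D] cannot be satisfied
   beyond [w] although the other variables may be increased arbitrarily. *)
Definition stable sg rho : Prop :=
  forall (D : pred 'I_r) (w nu : 'I_r -> R),
    (forall x, D x -> rho x = (w x)%:E) ->
    (forall x, ~~ D x -> (rho x < (w x)%:E)%E) ->
    (forall x, D x -> (val_at sg (asg_real w) x <= (w x)%:E)%E) ->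
    (forall x, w x <= nu x) ->
    (forall x, D x -> ((nu x)%:E <= val_at sg (asg_real nu) x)%E) ->
    forall x, D x -> nu x = w x.

(** By the third condition a value [-oo] always comes from the added disjunct, never from an
    infeasible linear program. *)
Definition strat_inv sg rho : Prop :=
  [/\ forall x, rho x = val_at sg rho x,
      asg_le rho mu,
      forall x, sg x = strat_init E x \/ (-oo < rho x)%E
    & stable sg rho].

Lemma inv_init : strat_inv (strat_init E) (fun=> -oo%E).
Proof.
(* [-oo] is not real, so [Dw] forces [D] to be empty. *)
split=> [x|x|x|D w nu Dw _ _ _ _ x /Dw //]; first by rewrite rhs_app_init.
  by rewrite leNye.
by left.
Qed.

Section Step.
Variables (sg sg' : strategy (or_bot E)) (rho rho' : assignment R r).
Hypotheses (inv_sg : strat_inv sg rho) (nsol : ~ solution T (or_bot E) rho).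
Hypothesis (imp : improvement T rho sg sg').

Lemma improvement_presolution : presolution T (sys_app sg') rho.
Proof. by case: imp => _ /(_ nsol)[]. Qed.

Lemma improvement_NNyp x : sg' x = strat_init E x \/ (-oo < val_at sg' rho x)%E.
Proof.
case: inv_sg => fix_rho _ init_or _.
have [eq|ne] := eqVneq (sg' x) (sg x).
  by rewrite eq -fix_rho; apply: init_or.
by right; case: imp => _ _ /(_ x ne); apply: le_lt_trans; rewrite leNye.
Qed.

Hypothesis (least : least_solution_ge T (sys_app sg') rho rho').

Lemma step_ge : asg_le rho rho'. Proof. by case: least. Qed.

Lemma step_fix x : rho' x = val_at sg' rho' x.
Proof. by case: least => sol _ _; rewrite {1}sol sys_val_app. Qed.

(** A changed strategy is strictly better at [rho] already, and monotonicity carries this gain over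
    to [rho']. *)
Lemma step_same x : rho' x = rho x -> sg' x = sg x.
Proof.
move=> eq; apply/eqP; apply: contraT => ne.
case: imp => _ _ /(_ x ne); case: inv_sg => <- _ _ _.
rewrite -eq step_fix => lt.
by have := aexp_val_mono T (rhs_app (sg' x)) step_ge; rewrite leNgt lt.
Qed.

Lemma inv_step : strat_inv sg' rho'.
Proof.
have [fix_rho rho_mu init_or stab] := inv_sg; split.
- exact: step_fix.
- apply: least_solution_ge_post (improvement_presolution) least _ rho_mu => x.
  rewrite sys_val_app; suff -> : mu x = rhs_val T (or_bot E x) mu.
    exact: rhs_app_le.
  by rewrite -[RHS]/(sys_val T (or_bot E) mu x) sys_val_or_bot -mu_sol.
- move=> x; have [|gt] := improvement_NNyp x; first by left.
  right; rewrite step_fix; apply: lt_le_trans gt _.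
  exact: aexp_val_mono step_ge.
move=> D w nu Dw nDw Fw w_nu nuF.
(* Where the step raised nothing the strategy is unchanged, so the old stability applies to this
   smaller set; raised variables satisfy [rho x < w x] and count as lying outside of it. *)
have eqD x : D x && (rho' x == rho x) -> nu x = w x.
  apply: (stab (fun x => D x && (rho' x == rho x)) w nu) => //= {}x.
  - by move=> /andP[/Dw <- /eqP].
  - rewrite negb_and; case Dx : (D x) => /=.
      rewrite -(Dw _ Dx) => ne.
      by rewrite lt_neqAle eq_sym ne step_ge.
    by move=> _; apply: le_lt_trans (step_ge x) (nDw _ _); rewrite Dx.
  - by move=> /andP[/Fw + /eqP/step_same <-].
  - by move=> /andP[/nuF + /eqP/step_same <-].
move=> x0 Dx0; apply/eqP; apply: contraT => ne0.
(* The reflected point must stay above [ka]: above [rho] on [D] to be comparable with leastness,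
   above [rho'] elsewhere for monotonicity. By [eqD], [ka] is strictly below [w] wherever [nu]
   differs from [w], so some [t > 0] is small enough. *)
pose ka x := if D x then rho x else rho' x.
have [t [t0 kat]] : exists t : R, 0 < t /\
    forall x, (ka x <= (w x - t * (nu x - w x))%:E)%E.
  have ka_lt x : nu x = w x /\ (ka x <= (w x)%:E)%E \/ (ka x < (w x)%:E)%E.
    rewrite /ka; case Dx : (D x); last by right; apply: nDw; rewrite Dx.
    have [eq|ne] := eqVneq (rho' x) (rho x).
      by left; rewrite eqD ?Dx ?eq ?eqxx //; split=> //; rewrite -Dw ?eq.
    right; rewrite -Dw // lt_neqAle eq_sym ne; exact: step_ge.
  have : forall s : seq 'I_r, exists t : R, 0 < t /\
      forall x, x \in s -> (ka x <= (w x - t * (nu x - w x))%:E)%E.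
    elim=> [|x s [t [t0 Ht]]]; first by exists 1.
    have [t1 [t10 Ht1]] : exists t1 : R, 0 < t1 /\
        (ka x <= (w x - t1 * (nu x - w x))%:E)%E.
      have [[-> le]|] := ka_lt x; first by exists 1; rewrite subrr mulr0 subr0.
      case: (ka x) => [k| |] //; last by exists 1; rewrite leNye.
      rewrite lte_fin => kw; exists ((w x - k) / (nu x - w x + 1)).
      have d0 : 0 < nu x - w x + 1 by have := w_nu x; lra.
      rewrite divr_gt0 ?subr_gt0 // lee_fin; split=> //.
      have := w_nu x; set d := nu x - w x => wnu.
      have -> : (w x - k) / (d + 1) * d = (w x - k) - (w x - k) / (d + 1).
        by field; rewrite gt_eqF.
      have : 0 < (w x - k) / (d + 1) by rewrite divr_gt0 // subr_gt0.
      lra.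
    have mono (a b : R) y : a <= b ->
        ((w y - b * (nu y - w y))%:E <= (w y - a * (nu y - w y))%:E)%E.
      by rewrite lee_fin => ab; have := w_nu y; nra.
    exists (Num.min t t1); rewrite lt_min t0 t10; split=> // y.
    rewrite inE => /orP[/eqP->|ys].
      by apply: le_trans Ht1 (mono _ _ _ _); rewrite ge_min lexx orbT.
    by apply: le_trans (Ht _ ys) (mono _ _ _ _); rewrite ge_min lexx.
  case/(_ (enum 'I_r)) => t [t0 Ht]; exists t; split=> // x.
  by apply: Ht; rewrite mem_enum.
(* The reflection of [nu] at [w]: [w] is [(1 - s) v + s nu] for [s = t / (1 + t)]. *)
pose v x := w x - t * (nu x - w x).
pose la : assignment R r := fun x => if D x then (v x)%:E else rho' x.
have la_rho' : asg_le la rho'.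
  move=> x; rewrite /la; case: ifP => // Dx; rewrite Dw // lee_fin /v.
  by have := w_nu x; nra.
have la_v : asg_le la (asg_real v).
  move=> x; rewrite /la /asg_real; case Dx : (D x) => //.
  by have := kat x; rewrite /ka Dx.
have rho_la : asg_le rho la.
  move=> x; rewrite /la; case Dx : (D x); last exact: step_ge.
  by have := kat x; rewrite /ka Dx.
(* Off [D] this is monotonicity below [rho']. On [D], an equation exceeding [v] at [v] and reaching
   [nu] at [nu] would by concavity exceed [w] at [w], against [Fw]. *)
have la_post : asg_le (sys_val T (sys_app sg') la) la.
  move=> x; rewrite sys_val_app /la; case Dx : (D x); last first.
    rewrite step_fix; exact: aexp_val_mono.
  apply: le_trans (aexp_val_mono T _ la_v) _; rewrite leNgt; apply/negP => gt.
  (* The value may be [+oo], but concavity is applied to real bounds. *)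
  have [c [vc cF]] : exists c : R, v x < c /\ (c%:E <= val_at sg' (asg_real v) x)%E.
    case: (val_at sg' (asg_real v) x) gt => [c| |] //.
      by rewrite lte_fin => vc; exists c.
    by move=> _; exists (v x + 1); rewrite leey; split=> //; lra.
  have t1 : 0 < 1 + t by lra.
  pose s := t / (1 + t).
  have s01 : 0 <= s <= 1.
    by rewrite divr_ge0 ?ler_pdivrMr //=; lra.
  have := aexp_app_concave s01 cF (nuF x Dx).
  have -> : (fun y => (1 - s) * v y + s * nu y) = w.
    by apply/funext => y; rewrite /v /s; field; rewrite gt_eqF.
  move=> /le_trans/(_ (Fw x Dx)); rewrite lee_fin; apply/negP; rewrite -ltNge.
  have -> : w x = (1 - s) * v x + s * nu x.
    by rewrite /v /s; field; rewrite gt_eqF.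
  have : 0 < 1 - s.
    have -> : 1 - s = (1 + t)^-1 by rewrite /s; field; rewrite gt_eqF.
    by rewrite invr_gt0.
  nra.
(* Leastness gives [rho' <= la], yet at [x0] the point [la] is strictly below [w x0 = rho' x0]. *)
have := least_solution_ge_post improvement_presolution least la_post rho_la x0.
rewrite /la Dx0 Dw // lee_fin /v.
have : w x0 < nu x0 by rewrite lt_neqAle eq_sym ne0 w_nu.
nra.
Qed.

End Step.

Lemma aexp_val_congr (a : aexp R n m r) rho nu :
  (-oo < aexp_val T a rho)%E ->
  (forall x, (-oo < rho x)%E -> nu x = rho x) ->
  aexp_val T a nu = aexp_val T a rho.
Proof.
case: a => [//|s j y] gt eq /=; congr abs_sem; apply/funext => i; apply: eq.
exact: aexp_val_arg gt i.
Qed.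

Lemma inv_fin sg rho : strat_inv sg rho -> forall x, (rho x < +oo)%E.
Proof. by case=> _ le _ _ x; apply: le_lt_trans (le x) (mu_fin x). Qed.

(** Stability speaks of points above [rho]; the maximum of [nu] and [rho] is one, and by
    monotonicity still a presolution. *)
Lemma greatest_presolution sg rho (nu : 'I_r -> R) : strat_inv sg rho ->
  (forall x, (-oo < rho x)%E -> ((nu x)%:E <= val_at sg (asg_real nu) x)%E) ->
  forall x, (-oo < rho x)%E -> ((nu x)%:E <= rho x)%E.
Proof.
move=> irho pre; have [fix_rho rho_mu init_or stab] := irho.
(* At a value [-oo], [fine] returns 0, which is strictly above, as stability requires off [D]. *)
pose w x := fine (rho x).
have wE x : (-oo < rho x)%E -> rho x = (w x)%:E.
  by move=> gt; rewrite fineK // fin_numE -ltey -ltNye gt (inv_fin irho).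
pose nu' x := Num.max (w x) (nu x).
have le_nu' : asg_le (asg_real nu) (asg_real nu').
  by move=> x; rewrite lee_fin /nu' le_max lexx orbT.
have le_w : asg_le (asg_real w) (asg_real nu').
  by move=> x; rewrite lee_fin /nu' le_max lexx.
have Fw x : (-oo < rho x)%E -> val_at sg (asg_real w) x = (w x)%:E.
  move=> gt; rewrite -wE // [RHS]fix_rho; apply: aexp_val_congr.
    by rewrite -fix_rho.
  by move=> z /wE.
move=> x gt; rewrite wE // -(stab (fun x => (-oo < rho x)%E) w nu') //.
- exact: le_nu'.
- by move=> y; rewrite -leNgt leeNy_eq => /eqP ->; rewrite ltNyr.
- by move=> y /Fw ->.
- by move=> y gty; rewrite /nu' EFin_max ge_max
    -{1}(Fw y gty) !aexp_val_mono //= (le_trans (pre y gty)) // aexp_val_mono.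
Qed.

(** With equal equations, [rho1] is a presolution for [sg] on these variables, hence at most
    [rho]. *)
Lemma same_strategy_value sg sg1 rho rho1 : strat_inv sg rho -> strat_inv sg1 rho1 ->
  asg_le rho rho1 ->
  (forall x, (-oo < rho x)%E -> rhs_app (sg1 x) = rhs_app (sg x)) ->
  forall x, (-oo < rho x)%E -> rho1 x = rho x.
Proof.
move=> irho irho1 le same x gt; apply/eqP; rewrite eq_le le andbT.
have re y : (-oo < rho y)%E -> rho1 y = (fine (rho1 y))%:E.
  move=> gty; rewrite fineK // fin_numE -ltey -ltNye (inv_fin irho1) andbT.
  exact: lt_le_trans gty (le y).
have le1 : asg_le rho1 (asg_real (fine \o rho1)).
  move=> y; have := inv_fin irho1 y; rewrite /asg_real /=.
  by case: (rho1 y) => //= _; rewrite leNye.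
rewrite re //; apply: (@greatest_presolution sg rho (fine \o rho1)) => // y gty.
rewrite /= -re // -same //; case: irho1 => {1}-> _ _ _.
exact: aexp_val_mono.
Qed.

(** Such a [tau] extends a past strategy whose value has been overtaken, so it cannot extend the
    current one. *)
Definition dead (tau : strategy E) rho : Prop :=
  exists sg0 rho0, [/\ strat_inv sg0 rho0, asg_le rho0 rho,
    forall x, (-oo < rho0 x)%E -> rhs_app (tau x) = rhs_app (sg0 x) &
    exists x, (-oo < rho0 x < rho x)%E].

Hypothesis E_gt0 : forall x, (0 < size (E x))%N.

(** The bound counts strategies of [E], not of [or_bot E]. Where [sg] selects the added disjunct the
    value is [-oo], and any strategy of the nonempty right-hand side may stand in. *)
Lemma strategy_extension sg rho : strat_inv sg rho ->
  exists tau : strategy E,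
    forall x, (-oo < rho x)%E -> rhs_app (tau x) = rhs_app (sg x).
Proof.
move=> [fix_rho _ _ _].
have H x : exists a : strat_rhs (E x),
    (-oo < rho x)%E -> rhs_app a = rhs_app (sg x).
  have [lt|ge] := ltnP (tag (sg x)) (size (E x)).
    exists (Tagged (fun l => strat_aexp (tnth (in_tuple (E x)) l))
      ([ffun p => strat_fun (tagged (sg x)) (val p)]
         : strat_aexp (tnth (in_tuple (E x)) (Ordinal lt)))) => _.
    rewrite /rhs_app /= aexp_app_strat; congr aexp_app.
    by rewrite !(tnth_nth (Const 0%E)) /= nth_rcons lt.
  exists (Tagged (fun l => strat_aexp (tnth (in_tuple (E x)) l))
      ([ffun=> false] : strat_aexp (tnth (in_tuple (E x)) (Ordinal (E_gt0 x))))).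
  rewrite fix_rho /rhs_app; move: (strat_fun (tagged (sg x))) => g.
  suff -> : tnth (in_tuple (or_bot E x)) (tag (sg x)) = Const -oo%E.
    by rewrite /= ltxx.
  rewrite (tnth_nth (Const 0%E)) /= nth_rcons ltnNge ge /=.
  suff -> : tag (sg x) = size (E x) :> nat by rewrite eqxx.
  apply/eqP; rewrite eqn_leq ge andbT -ltnS.
  by apply: leq_trans (ltn_ord (tag (sg x))) _; rewrite size_rcons.
have [f fP] : {f : forall x, strat_rhs (E x) |
    forall x, (-oo < rho x)%E -> rhs_app (f x) = rhs_app (sg x)}.
  by exists (fun x => sval (cid (H x))) => x; apply: svalP (cid (H x)).
by exists (finfun f) => x; rewrite ffunE; apply: fP.
Qed.

(** The sum of the two cardinals is a potential: each step either makes a variable finite or kills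
    one more strategy. *)
Lemma run_inv k sg rho : run T k sg rho ->
  strat_inv sg rho /\ exists V : {set strategy E},
    (forall tau, tau \in V -> dead tau rho) /\
    (k <= #|V| + #|[set x | (-oo < rho x)%E]%SET|)%N.
Proof.
elim=> [|{}k {}sg {}rho sg' rho' _ [irho [V [deadV kV]]] [nsol imp least]].
  by split; [exact: inv_init|exists finset.set0; split=> // tau; rewrite inE].
have irho' := inv_step irho nsol imp least; split=> //.
have ge := step_ge least.
pose P := [set x | (-oo < rho x)%E]%SET.
pose P' := [set x | (-oo < rho' x)%E]%SET.
have PP' : P \subset P'.
  by apply/fintype.subsetP => x; rewrite !inE => gt; apply: lt_le_trans gt (ge x).
have deadW tau : dead tau rho -> dead tau rho'.
  case=> sg0 [rho0 [i0 le0 ext0 [x /andP[gtx ltx]]]]; exists sg0, rho0; split=> //.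
    by move=> y; apply: le_trans (le0 y) (ge y).
  by exists x; rewrite gtx (lt_le_trans ltx (ge x)).
have [eqP'|neP] := eqVneq P P'; last first.
  exists V; split=> [tau /deadV|]; first exact: deadW.
  have : P \proper P' by rewrite finset.properEneq neP.
  by move=> /proper_card; rewrite -/P -/P' in kV *; lia.
(* The extension of the strategy being replaced is the one that dies in this step. *)
have [tau ext] := strategy_extension irho.
have [x ltx] : exists x, (rho x < rho' x)%E.
  have [//|H] := pselect (exists x, (rho x < rho' x)%E).
  have eq : rho' = rho.
    apply/funext => x; apply/eqP; rewrite eq_le ge andbT leNgt.
    by apply/negP => lt; apply: H; exists x.
  case: imp => _ /(_ nsol)[_ []]; case: least => + _ _.
  by rewrite eq.
have gtx : (-oo < rho x)%E.
  have : x \in P' by rewrite inE; apply: le_lt_trans ltx; rewrite leNye.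
  by rewrite -eqP' inE.
(* Were [tau] dead before, its witness [rho0] would agree with [rho] on the finite variables of
   [rho0], so nothing would have been overtaken. *)
have tauV : tau \notin V.
  apply/negP => /deadV[sg0 [rho0 [i0 le0 ext0 [y /andP[gty]]]]].
  rewrite (same_strategy_value i0 irho le0) ?ltxx // => z gtz.
  by rewrite -ext0 // ext //; apply: lt_le_trans gtz (le0 z).
exists (tau |: V)%SET; split.
  move=> t; rewrite inE => /orP[/set1P ->|/deadV]; last exact: deadW.
  by exists sg, rho; split=> //; exists x; rewrite gtx.
by rewrite cardsU1 tauV; rewrite -/P -/P' -?eqP' in kV *; lia.
Qed.

Lemma run_length k sg rho : run T k sg rho -> (k <= #|strategy E| + #|'I_r|)%N.
Proof.
case/run_inv=> _ [V [_ kV]]; apply: leq_trans kV _.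
by rewrite leq_add // max_card.
Qed.

Lemma improvement_intro sg sg' rho : strat_inv sg rho ->
  (forall x, sg' x != sg x -> (rho x < val_at sg' rho x)%E) ->
  (forall x, (rho x < rhs_val T (or_bot E x) rho)%E ->
     (rho x < val_at sg' rho x)%E) ->
  improvement T rho sg sg'.
Proof.
move=> [fix_rho _ _ _] ne gt.
have ge : asg_le rho (sys_val T (sys_app sg') rho).
  move=> x; rewrite sys_val_app; have [eq|/ne/ltW//] := eqVneq (sg' x) (sg x).
  by rewrite eq -fix_rho.
split=> [x|nsol|x /ne]; last by rewrite {1}fix_rho.
  by rewrite sys_val_app -fix_rho.
split=> // eq; apply: nsol; apply/funext => x.
apply/eqP; rewrite eq_le; apply/andP; split.
  by rewrite {1}fix_rho; apply: rhs_app_le.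
rewrite leNgt; apply/negP => /gt; rewrite -sys_val_app -eq ltxx //.
Qed.

End Iteration.

(** * Constraints for statements *)

Section Rows.
Variable R : realType.

Definition lrow : Type := (seq (R * nat) * R)%type.

Definition lin (n : nat) (c : R) (f : 'I_n -> R) (v : nat) : seq (R * nat) :=
  [seq (c * f j, (v + j)%N) | j <- enum 'I_n].

Definition row_sat (xi : nat -> R) (a : lrow) : bool :=
  \sum_(cv <- a.1) cv.1 * xi cv.2 <= a.2.

Definition conj (rows : seq lrow) : lra_formula R :=
  foldr (fun a phi => FAnd (FLe (a.1, 0) ([::], a.2)) phi) (FTrue R) rows.

(** Each equation is a pair of inequalities. The accumulator avoids concatenations, whose total cost
    along nested sequences would exceed linear time. *)
Definition assign_rows (n : nat) (A : 'M[R]_n) (b : 'cV[R]_n) (i o : nat)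
    (s : seq 'I_n) (acc : seq lrow) : seq lrow :=
  foldr (fun (k : 'I_n) acc =>
    ((-1, (o + k)%N) :: lin 1 (A k) i, - b k 0) ::
    ((1, (o + k)%N) :: lin (-1) (A k) i, b k 0) :: acc) acc s.

Definition guard_rows (k n : nat) (A : 'M[R]_(k, n)) (b : 'cV[R]_k) (i : nat)
    (s : seq 'I_k) (acc : seq lrow) : seq lrow :=
  foldr (fun (l : 'I_k) acc => (lin 1 (A l) i, b l 0) :: acc) acc s.

(** Needed for guards: they keep the state, but the states before and after live in separate blocks
    of variables. *)
Definition copy_rows (n i o : nat) (s : seq 'I_n) (acc : seq lrow) : seq lrow :=
  foldr (fun (j : 'I_n) acc =>
    ([:: (1, (i + j)%N); (-1, (o + j)%N)], 0) ::
    ([:: (-1, (i + j)%N); (1, (o + j)%N)], 0) :: acc) acc s.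

(* The values of the program variables before and after the statement are the
   real variables [i, ..., i + n - 1] and [o, ..., o + n - 1]. *)
Definition elem_rows (n : nat) (s : stmt R n) (i o : nat) (acc : seq lrow)
    : seq lrow :=
  match s with
  | Assign A b => assign_rows A b i o (enum 'I_n) acc
  | Guard k A b => copy_rows i o (enum 'I_n) (guard_rows A b i (enum 'I_k) acc)
  | _ => acc
  end.

(** The numbering follows the preorder of [choice_pos], as [pos_var] prescribes. *)
Fixpoint next_bool (n : nat) (s : stmt R n) (b : nat) : nat :=
  match s with
  | Seq s0 s1 => next_bool s1 (next_bool s0 b)
  | Defs.Choice s0 s1 => next_bool s1 (next_bool s0 b.+1)
  | _ => b
  end.

Fixpoint next_real (n : nat) (s : stmt R n) (f : nat) : nat :=
  match s with
  | Seq s0 s1 => next_real s1 (next_real s0 (f + n))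
  | Defs.Choice s0 s1 => next_real s1 (next_real s0 f)
  | _ => f
  end.

(* [b] and [f] are the first unused Boolean and real variables. *)
Fixpoint stmt_form (n : nat) (s : stmt R n) (i o b f : nat) : lra_formula R :=
  match s with
  | Seq s0 s1 =>
      FAnd (stmt_form s0 i f b (f + n))
           (stmt_form s1 f o (next_bool s0 b) (next_real s0 (f + n)))
  | Defs.Choice s0 s1 =>
      FAnd (FOr (FBool R b) (stmt_form s0 i o b.+1 f))
           (FOr (FNot (FBool R b))
              (stmt_form s1 i o (next_bool s0 b.+1) (next_real s0 f)))
  | _ => conj (elem_rows s i o [::])
  end.

(** Counterpart of [stmt_form] for sequential statements; the value at a choice is a dummy. *)
Fixpoint stmt_rows (n : nat) (s : stmt R n) (i o f : nat) (acc : seq lrow)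
    : seq lrow :=
  match s with
  | Seq s0 s1 =>
      stmt_rows s1 f o (next_real s0 (f + n)) (stmt_rows s0 i f (f + n) acc)
  | Defs.Choice _ _ => acc
  | _ => elem_rows s i o acc
  end.

Definition block (n : nat) (xi : nat -> R) (v : nat) : 'cV[R]_n :=
  \col_j xi (v + j)%N.

Lemma block_ext n xi xi' v : (forall k, (k < v + n)%N -> xi k = xi' k) ->
  block n xi v = block n xi' v.
Proof. by move=> eq; apply/colP => j; rewrite !mxE eq // ltn_add2l. Qed.

Lemma lin_sum k n c (A : 'M[R]_(k, n)) i v xi :
  \sum_(cv <- lin c (A i) v) cv.1 * xi cv.2 = c * (A *m block n xi v) i 0.
Proof.
rewrite big_map big_enum /= mxE mulr_sumr; apply: eq_bigr => j _.
by rewrite mxE mulrA.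
Qed.

Lemma models_conj M rows :
  models M (conj rows) = all (row_sat (real_val M)) rows.
Proof.
elim: rows => //= a rows ->; congr (_ && _).
by rewrite /lin_val /row_sat /= big_nil add0r addr0.
Qed.

Lemma all_foldr1 (I : Type) (P : pred lrow) (f : I -> lrow) acc s :
  all P (foldr (fun i acc => f i :: acc) acc s) = all (P \o f) s && all P acc.
Proof. by elim: s => //= i s ->; rewrite andbA. Qed.

Lemma all_foldr2 (I : Type) (P : pred lrow) (f g : I -> lrow) acc s :
  all P (foldr (fun i acc => f i :: g i :: acc) acc s) =
  all (fun i => P (f i) && P (g i)) s && all P acc.
Proof. by elim: s => //= i s ->; rewrite !andbA. Qed.

Lemma all_enumP n (P : pred 'I_n) : reflect (forall i, P i) (all P (enum 'I_n)).
Proof.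
by apply: (iffP allP) => H i //; apply: H; rewrite mem_enum.
Qed.

Lemma assign_rows_sat n (A : 'M[R]_n) b i o acc xi :
  all (row_sat xi) (assign_rows A b i o (enum 'I_n) acc) =
  (block n xi o == A *m block n xi i + b) && all (row_sat xi) acc.
Proof.
have Eo k : block n xi o k 0 = xi (o + k)%N by rewrite mxE.
have Ei k : (A *m block n xi i + b) k 0 = (A *m block n xi i) k 0 + b k 0.
  by rewrite mxE.
rewrite all_foldr2; congr (_ && _).
apply/all_enumP/eqP => [H|/colP H k]; first apply/colP => k.
  have /andP[] := H k; rewrite /row_sat !big_cons /= !lin_sum.
  by rewrite Eo Ei => ? ?; apply/eqP; lra.
have := H k; rewrite Eo Ei /row_sat !big_cons /= !lin_sum => ->.
apply/andP; split; lra.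
Qed.

Lemma guard_rows_sat k n (A : 'M[R]_(k, n)) b i acc xi :
  all (row_sat xi) (guard_rows A b i (enum 'I_k) acc) =
  [forall l, (A *m block n xi i) l 0 <= b l 0] && all (row_sat xi) acc.
Proof.
rewrite all_foldr1; congr (_ && _).
by apply/all_enumP/forallP => H l; have := H l;
  rewrite /row_sat /= lin_sum mul1r.
Qed.

Lemma copy_rows_sat n i o acc xi :
  all (row_sat xi) (copy_rows i o (enum 'I_n) acc) =
  (block n xi o == block n xi i) && all (row_sat xi) acc.
Proof.
have E v k : block n xi v k 0 = xi (v + k)%N by rewrite mxE.
rewrite all_foldr2; congr (_ && _).
apply/all_enumP/eqP => [H|/colP H k]; first apply/colP => k.
  have /andP[] := H k; rewrite /row_sat !big_cons !big_nil /=.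
  by rewrite !E => ? ?; apply/eqP; lra.
have := H k; rewrite !E /row_sat !big_cons !big_nil /= => ->.
apply/andP; split; lra.
Qed.

Definition elementary n (s : stmt R n) : bool :=
  if s is (Assign _ _ | Guard _ _ _) then true else false.

Lemma elem_rows_sat n (s : stmt R n) i o acc xi : elementary s ->
  all (row_sat xi) (elem_rows s i o acc) <->
  sem s [set block n xi i] (block n xi o) /\ all (row_sat xi) acc.
Proof.
case: s => //= [A b|k A b] _.
  rewrite assign_rows_sat; split=> [/andP[/eqP -> ->]|].
    by split=> //; exists (block n xi i).
  by case=> -[_ -> ->] ->; rewrite eqxx.
rewrite copy_rows_sat guard_rows_sat; split.
  by case/and3P=> /eqP -> /forallP ? ->.
by case=> -[-> H] ->; rewrite eqxx andbT; apply/forallP.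
Qed.

Lemma elem_rows_dep n (s : stmt R n) i o acc xi xi' : elementary s ->
  (forall k, (k < i + n)%N -> xi k = xi' k) ->
  (forall k, (k < o + n)%N -> xi k = xi' k) ->
  all (row_sat xi) acc = all (row_sat xi') acc ->
  all (row_sat xi) (elem_rows s i o acc) = all (row_sat xi') (elem_rows s i o acc).
Proof.
case: s => //= [A b|k A b] _ /block_ext ei /block_ext eo ea.
  by rewrite !assign_rows_sat ea ei eo.
by rewrite !copy_rows_sat !guard_rows_sat ea ei eo.
Qed.

Lemma next_boolE n (s : stmt R n) b : next_bool s b = (b + size (choice_pos s))%N.
Proof.
elim: s b => [A c|k A c|s0 IH0 s1 IH1|s0 IH0 s1 IH1] b /=; rewrite ?addn0 //;
  rewrite IH1 IH0 size_cat !size_map; lia.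
Qed.

Lemma leq_next_real n (s : stmt R n) f : (f <= next_real s f)%N.
Proof.
elim: s f => [A c|k A c|s0 IH0 s1 IH1|s0 IH0 s1 IH1] f //=.
  by apply: leq_trans (IH1 _); apply: leq_trans (IH0 _); rewrite leq_addr.
by apply: leq_trans (IH1 _); apply: leq_trans (IH0 _).
Qed.

Definition agree (B : nat -> bool) (b : nat) (ps : seq (seq bool))
    (g : seq bool -> bool) : Prop :=
  {in ps, forall p, B (b + index p ps)%N = g p}.

Lemma agree_cat B b ps0 ps1 g :
  agree B b (map (cons false) ps0 ++ map (cons true) ps1) g ->
  agree B b ps0 (fun p => g (false :: p)) /\
  agree B (b + size ps0)%N ps1 (fun p => g (true :: p)).
Proof.
have injc d : injective (cons d : seq bool -> _) by move=> p q [].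
move=> H; split=> p pP.
  rewrite -H ?mem_cat ?map_f // index_cat map_f //.
  by rewrite index_map.
rewrite -H ?mem_cat ?map_f ?orbT // index_cat size_map.
rewrite ifF; first by rewrite index_map // addnA.
by apply/mapP => -[].
Qed.

Lemma agree_Seq n (s0 s1 : stmt R n) B b g :
  agree B b (choice_pos (Seq s0 s1)) g ->
  agree B b (choice_pos s0) (fun p => g (false :: p)) /\
  agree B (next_bool s0 b) (choice_pos s1) (fun p => g (true :: p)).
Proof. by move=> /agree_cat; rewrite next_boolE. Qed.

Lemma agree_Choice n (s0 s1 : stmt R n) B b g :
  agree B b (choice_pos (Defs.Choice s0 s1)) g ->
  [/\ B b = g [::],
      agree B b.+1 (choice_pos s0) (fun p => g (false :: p)) &
      agree B (next_bool s0 b.+1) (choice_pos s1) (fun p => g (true :: p))].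
Proof.
rewrite next_boolE => H.
have [|? ?] := @agree_cat B b.+1 (choice_pos s0) (choice_pos s1) g.
  move=> p pP; rewrite -H /=; last by rewrite inE pP orbT.
  by case: eqP pP => [<-|_ _]; [rewrite mem_cat; case/orP=> /mapP[]|rewrite addnS].
by split=> //; rewrite -H ?inE //= addn0.
Qed.

Lemma stmt_form_dep n (s : stmt R n) i o b f B xi xi' :
  (i + n <= f)%N -> (o + n <= f)%N ->
  (forall k, (k < next_real s f)%N -> xi k = xi' k) ->
  models (Valuation xi B) (stmt_form s i o b f) =
  models (Valuation xi' B) (stmt_form s i o b f).
Proof.
elim: s i o b f => [A c|k A c|s0 IH0 s1 IH1|s0 IH0 s1 IH1] i o b f /= lei leo eq.
- rewrite !models_conj; apply: (@elem_rows_dep n (Assign A c)) => // k ltk;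
    by apply: eq; apply: leq_trans ltk _.
- rewrite !models_conj; apply: (@elem_rows_dep n (Guard A c)) => // l ltl;
    by apply: eq; apply: leq_trans ltl _.
- have le := leq_next_real s0 (f + n).
  rewrite IH0 1?IH1 //; try lia.
  move=> k ltk; apply: eq; apply: leq_trans ltk _; exact: leq_next_real.
- have le := leq_next_real s0 f.
  rewrite IH0 1?IH1 //; try lia.
  move=> k ltk; apply: eq; apply: leq_trans ltk _; exact: leq_next_real.
Qed.

Lemma stmt_form_sound n (s : stmt R n) i o b f B xi g :
  agree B b (choice_pos s) g ->
  models (Valuation xi B) (stmt_form s i o b f) ->
  sem (stmt_app s g) [set block n xi i] (block n xi o).
Proof.
elim: s i o b f g => [A c|k A c|s0 IH0 s1 IH1|s0 IH0 s1 IH1] i o b f g.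
- by rewrite /stmt_form models_conj => _ /elem_rows_sat[].
- by rewrite /stmt_form models_conj => _ /elem_rows_sat[].
- move=> /agree_Seq[a0 a1] /= /andP[m0 m1]; apply/sem_point.
  by exists (block n xi f); [apply: IH0 m0|apply: IH1 m1].
- move=> /agree_Choice[Bb a0 a1] /= /andP[]; rewrite -Bb; case: (B b) => /=.
    by move=> _; apply: IH1.
  by move=> m0 _; apply: IH0 m0.
Qed.

(** Fresh variables receive the intermediate states. Variables below [f] are kept, so constraints on
    them from elsewhere survive; a branch not taken is satisfied by its guard literal. *)
Lemma stmt_form_complete n (s : stmt R n) i o b f B xi g :
  agree B b (choice_pos s) g -> (i + n <= f)%N -> (o + n <= f)%N ->
  sem (stmt_app s g) [set block n xi i] (block n xi o) ->
  exists2 xi', forall k, (k < f)%N -> xi' k = xi k &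
    models (Valuation xi' B) (stmt_form s i o b f).
Proof.
elim: s i o b f g xi => [A c|k A c|s0 IH0 s1 IH1|s0 IH0 s1 IH1] i o b f g xi.
- by move=> *; exists xi => //; rewrite models_conj; apply/elem_rows_sat.
- by move=> *; exists xi => //; rewrite models_conj; apply/elem_rows_sat.
- move=> /agree_Seq[a0 a1] lei leo /= /sem_point[z s0z s1z].
  pose xi1 k := if (f <= k)%N then
    (if insub (k - f)%N is Some j then z j 0 else 0) else xi k.
  have xi1f : block n xi1 f = z.
    by apply/colP => j; rewrite !mxE /xi1 leq_addr addKn valK.
  have xi1E k : (k < f)%N -> xi1 k = xi k by rewrite /xi1 ltnNge; case: (f <= k)%N.
  have B1 v : (v + n <= f)%N -> block n xi1 v = block n xi v.
    by move=> lev; apply: block_ext => k ltk; apply: xi1E; apply: leq_trans lev.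
  have [|||xi2 xi2E m0] := IH0 i f b (f + n)%N _ xi1 a0; rewrite ?xi1f ?B1 //.
    lia.
  have le := leq_next_real s0 (f + n).
  have B2 v : (v + n <= f + n)%N -> block n xi2 v = block n xi1 v.
    by move=> lev; apply: block_ext => k ltk; apply: xi2E; apply: leq_trans lev.
  have [|||xi3 xi3E m1] :=
    IH1 f o (next_bool s0 b) (next_real s0 (f + n)) _ xi2 a1; first lia.
  - lia.
  - by rewrite (B2 f) ?(B2 o) ?(B1 o) ?xi1f //; lia.
  exists xi3 => [k ltk|].
    rewrite xi3E ?xi2E ?xi1E //; lia.
  (* [xi3] differs from [xi2] only beyond the variables of the first formula. *)
  rewrite /= m1 andbT (@stmt_form_dep _ s0 _ _ _ _ _ xi3 xi2) //; lia.
- move=> /agree_Choice[Bb a0 a1] lei leo /=; rewrite -Bb; case Bbv : (B b) => sz.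
    have le := leq_next_real s0 f.
    have [||xi' xiE m1] := IH1 i o _ (next_real s0 f) _ xi a1 _ _ sz; [lia..|].
    exists xi' => [k ltk|]; last by rewrite m1.
    by rewrite xiE //; lia.
  have [xi' xiE m0] := IH0 i o _ f _ xi a0 lei leo sz.
  by exists xi' => //; rewrite m0.
Qed.

Fixpoint sequential n (s : stmt R n) : bool :=
  match s with
  | Seq s0 s1 => sequential s0 && sequential s1
  | Defs.Choice _ _ => false
  | _ => true
  end.

Lemma sequential_stmt_app n (s : stmt R n) g : sequential (stmt_app s g).
Proof.
elim: s g => //= [s0 IH0 s1 IH1|s0 IH0 s1 IH1] g; first by rewrite IH0 IH1.
by case: ifP.
Qed.

Lemma sequential_choice_pos n (s : stmt R n) : sequential s -> choice_pos s = [::].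
Proof. by elim: s => //= s0 IH0 s1 IH1 /andP[/IH0 -> /IH1 ->]. Qed.

Lemma stmt_app_sequential n (s : stmt R n) g : sequential s -> stmt_app s g = s.
Proof. by elim: s g => //= s0 IH0 s1 IH1 g /andP[/IH0 -> /IH1 ->]. Qed.

Lemma stmt_rows_sat n (s : stmt R n) i o b f acc xi B : sequential s ->
  all (row_sat xi) (stmt_rows s i o f acc) <->
  models (Valuation xi B) (stmt_form s i o b f) /\ all (row_sat xi) acc.
Proof.
elim: s i o b f acc => [A c|k A c|s0 IH0 s1 IH1|s0 IH0 s1 IH1] i o b f acc //.
- move=> _; rewrite /stmt_rows /stmt_form models_conj.
  have E acc' := @elem_rows_sat n (Assign A c) i o acc' xi isT.
  by split=> [/E[h ->]|[/E[h _] ha]]; [split=> //|]; apply/E.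
- move=> _; rewrite /stmt_rows /stmt_form models_conj.
  have E acc' := @elem_rows_sat n (Guard A c) i o acc' xi isT.
  by split=> [/E[h ->]|[/E[h _] ha]]; [split=> //|]; apply/E.
- move=> /= /andP[/IH0 {}IH0 /IH1 {}IH1].
  rewrite (IH1 _ _ (next_bool s0 b)) (IH0 _ _ b).
  by split=> [[-> [-> ->]]|[/andP[-> ->] ->]].
Qed.

End Rows.

(** * The SAT formula *)

Lemma models_and (R : realType) (M : valuation R) p q :
  models M (FAnd p q) = models M p && models M q.
Proof. by []. Qed.

Section SatFormula.
Variables (R : realType) (n m r : nat) (T : 'M[R]_(m, n)).
Implicit Types (rho : assignment R r) (xi : nat -> R) (a : aexp R n m r).

Definition tmpl_rows (y : 'I_m -> 'I_r) (u : nat) (s : seq 'I_m) (acc : seq (lrow R))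
    : seq (lrow R) :=
  foldr (fun (i : 'I_m) acc =>
    ((-1, y i : nat) :: lin 1 (T i) u, 0) :: acc) acc s.

(* The value of the variable [x] of the system is the real variable [x]; the
   real variable [r + x] is positive exactly if this value is not [-oo]. *)
Definition flag_rows (y : 'I_m -> 'I_r) (s : seq 'I_m) (acc : seq (lrow R))
    : seq (lrow R) :=
  foldr (fun (i : 'I_m) acc =>
    ([:: (-1, (r + y i)%N)], -1) :: acc) acc s.

Definition rho_rows rho (s : seq 'I_r) : seq (lrow R) :=
  foldr (fun (x : 'I_r) acc =>
    if rho x is c%:E then
      ([:: (1, x : nat)], c) :: ([:: (-1, x : nat)], - c) ::
      ([:: (-1, (r + x)%N)], -1) :: acc
    else ([:: (1, (r + x)%N)], 0) :: acc) [::] s.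

(** A nonpositive flag signals the value [-oo], which every real [t] exceeds. *)
Definition gt_form (x : nat) (t : linexp R) : lra_formula R :=
  FOr (FLe ([:: (1, (r + x)%N)], 0) ([::], 0)) (FLt ([:: (1, x)], 0) t).

(** Real variables in order: values, flags, state before, state after, intermediate states. The
    flags exclude arguments [-oo], whose concretization is empty. *)
Definition aexp_form a (b x : nat) : lra_formula R :=
  match a with
  | Const c => match c with
               | c%:E => gt_form x ([::], c)
               | +oo%E => FTrue R
               | -oo%E => FNot (FTrue R)
               end
  | Abs s j y =>
      FAnd (conj (flag_rows y (enum 'I_m) (tmpl_rows y (r + r) (enum 'I_m) [::])))
        (FAnd (stmt_form s (r + r) (r + r + n) b (r + r + n + n))
              (gt_form x (lin 1 (T j) (r + r + n), 0)))
  end.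

Definition aexp_next a (b : nat) : nat :=
  if a is Abs s _ _ then next_bool s b else b.

(** [D] collects the selection variables, one of which must be true in the end. All disjuncts share
    the same real variables; this does no harm, since a model selecting a single disjunct suffices
    for completeness. *)
Fixpoint rhs_form (e : rhs R n m r) (b : nat) (D : lra_formula R) (x : nat)
    : lra_formula R :=
  if e is a :: e' then
    FAnd (FOr (FNot (FBool R b)) (aexp_form a b.+1 x))
      (rhs_form e' (aexp_next a b.+1) (FOr (FBool R b) D) x)
  else D.

Definition sat_form (E : system R n m r) rho (x : 'I_r) : lra_formula R :=
  FAnd (conj (rho_rows rho (enum 'I_r))) (rhs_form (E x) 0 (FNot (FTrue R)) x).

Lemma tmpl_rows_sat y u acc xi :
  all (row_sat xi) (tmpl_rows y u (enum 'I_m) acc) <->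
  (forall i, (T *m block n xi u) i 0 <= xi (y i)) /\ all (row_sat xi) acc.
Proof.
rewrite all_foldr1; split.
  move=> /andP[/all_enumP H ->]; split=> // i; have := H i.
  by rewrite /= /row_sat big_cons /= lin_sum; lra.
case=> H ->; rewrite andbT; apply/all_enumP => i; have := H i.
by rewrite /= /row_sat big_cons /= lin_sum; lra.
Qed.

Lemma flag_rows_sat y acc xi :
  all (row_sat xi) (flag_rows y (enum 'I_m) acc) <->
  (forall i, 1 <= xi (r + y i)%N) /\ all (row_sat xi) acc.
Proof.
rewrite all_foldr1; split.
  move=> /andP[/all_enumP H ->]; split=> // i; have := H i.
  by rewrite /= /row_sat big_seq1 /=; lra.
case=> H ->; rewrite andbT; apply/all_enumP => i; have := H i.
by rewrite /= /row_sat big_seq1 /=; lra.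
Qed.

Definition rho_sat xi rho : Prop := forall x : 'I_r,
  if rho x is c%:E then xi x = c /\ 1 <= xi (r + x)%N else xi (r + x)%N <= 0.

Lemma rho_rows_sat xi rho :
  all (row_sat xi) (rho_rows rho (enum 'I_r)) <-> rho_sat xi rho.
Proof.
rewrite /rho_rows /rho_sat.
have -> : (forall x : 'I_r,
    if rho x is c%:E then xi x = c /\ 1 <= xi (r + x)%N else xi (r + x)%N <= 0) <->
    (forall x : 'I_r, x \in enum 'I_r ->
    if rho x is c%:E then xi x = c /\ 1 <= xi (r + x)%N else xi (r + x)%N <= 0).
  by split=> [H x _|H x]; [exact: H|apply: H; rewrite mem_enum].
elim: (enum _) => [|x s IH]; first by split.
have -> : (forall y, y \in x :: s ->
    if rho y is c%:E then xi y = c /\ 1 <= xi (r + y)%N else xi (r + y)%N <= 0) <->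
    (if rho x is c%:E then xi x = c /\ 1 <= xi (r + x)%N else xi (r + x)%N <= 0) /\
    (forall y, y \in s ->
    if rho y is c%:E then xi y = c /\ 1 <= xi (r + y)%N else xi (r + y)%N <= 0).
  split=> [H|[H0 H] y]; last by rewrite inE => /orP[/eqP ->|/H].
  by split=> [|y ys]; apply: H; rewrite inE ?eqxx ?ys ?orbT.
rewrite -IH /=; case: (rho x) => [c| |] /=; rewrite /row_sat !big_seq1 /=.
- split=> [/and4P[? ? ? ->]|[[-> ?] ->]]; first by split=> //; split; lra.
  by rewrite andbT; apply/and3P; split; lra.
- split=> [/andP[? ->]|[? ->]]; first by split=> //; lra.
  by rewrite andbT; lra.
- split=> [/andP[? ->]|[? ->]]; first by split=> //; lra.
  by rewrite andbT; lra.
Qed.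

Lemma gt_form_models xi B rho (x : 'I_r) t :
  rho_sat xi rho -> (rho x < +oo)%E ->
  models (Valuation xi B) (gt_form x t) = (rho x < (lin_val xi t)%:E)%E.
Proof.
have E1 v : lin_val xi ([:: (1, v)], 0) = xi v.
  by rewrite /lin_val big_seq1 /= mul1r addr0.
have E0 : lin_val xi ([::], 0) = 0 by rewrite /lin_val big_nil addr0.
move=> /(_ x) + fin; rewrite /gt_form /= !E1 E0.
case: (rho x) fin => [c| |] //= _; last by move=> ->; rewrite ltNyr.
by case=> -> le; rewrite lte_fin; case: leP => //; lra.
Qed.

Lemma aexp_form_sound a b (x : 'I_r) B xi g rho :
  rho_sat xi rho -> (forall z, (rho z < +oo)%E) ->
  agree B b (aexp_pos a) g ->
  models (Valuation xi B) (aexp_form a b x) ->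
  (rho x < aexp_val T (aexp_app a g) rho)%E.
Proof.
move=> rs fin; case: a => [[c| |]|s j y] // ag.
- rewrite /aexp_form (gt_form_models _ _ rs) //=.
  by rewrite /lin_val /= big_nil add0r.
- rewrite /aexp_form; rewrite !models_and; rewrite models_conj => /and3P[].
  move=> /flag_rows_sat[flags /tmpl_rows_sat[tm _]] ms.
  rewrite (gt_form_models _ _ rs) // /lin_val /= addr0 lin_sum mul1r => lt.
  apply: lt_le_trans lt _; rewrite /abs_sem alphaE.
  apply: ereal_sup_ubound; exists (block n xi (r + r + n)) => //.
  apply/sem_point; exists (block n xi (r + r)).
    move=> i; have := rs (y i); have := flags i; have := tm i.
    have := fin (y i); case: (rho (y i)) => [c _|//|_].
      by move=> le _ [<- _]; rewrite lee_fin.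
    by move=> _ /= le1 le0; have := le_trans le1 le0; rewrite ler10.
  exact: stmt_form_sound ag ms.
Qed.

Lemma rho_sat_ext xi xi' rho : (forall k, (k < r + r)%N -> xi' k = xi k) ->
  rho_sat xi rho -> rho_sat xi' rho.
Proof.
move=> eq H x; have := H x; have := ltn_ord x.
by case: (rho x) => [c| |] ltx; rewrite !eq //; lia.
Qed.

Lemma aexp_form_complete a b (x : 'I_r) B xi g rho :
  rho_sat xi rho -> (forall z, (rho z < +oo)%E) ->
  agree B b (aexp_pos a) g ->
  (rho x < aexp_val T (aexp_app a g) rho)%E ->
  exists2 xi', rho_sat xi' rho & models (Valuation xi' B) (aexp_form a b x).
Proof.
move=> rs fin; case: a => [c|s j y] ag lt.
  exists xi => //; case: c {ag} lt => [c lt|//|]; last by rewrite ltNge leNye.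
  by rewrite /aexp_form (gt_form_models _ _ rs) // /lin_val /= big_nil add0r.
have gtN : (-oo < aexp_val T (aexp_app (Abs s j y) g) rho)%E.
  by apply: le_lt_trans lt; rewrite leNye.
have argN := aexp_val_arg gtN.
have /ereal_sup_gt[_ [z /sem_point[w wg sz] <-] {}lt] : (rho x < ereal_sup
    [set ((T *m z) j 0)%:E
       | z in sem (stmt_app s g) (gamma T (fun i => rho (y i)))])%E.
  by rewrite -alphaE.
pose xi1 k := if (k < r + r)%N then xi k else
  if insub (k - (r + r))%N is Some i then w i 0 else
  if insub (k - (r + r + n))%N is Some i then z i 0 else 0.
have xi1E k : (k < r + r)%N -> xi1 k = xi k by rewrite /xi1 => ->.
have xi1u : block n xi1 (r + r) = w.
  by apply/colP => i; rewrite mxE /xi1 ltnNge leq_addr addKn valK.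
have xi1v : block n xi1 (r + r + n) = z.
  apply/colP => i; rewrite mxE /xi1 -addnA ltnNge leq_addr addKn.
  by rewrite insubF ?addnA ?addKn ?valK //; apply/negbTE; rewrite -leqNgt leq_addr.
have [|||xi' xi'E ms] := @stmt_form_complete R n s (r + r) (r + r + n) b
    (r + r + n + n) B xi1 g ag.
- lia.
- lia.
- by rewrite xi1u xi1v.
have rs' : rho_sat xi' rho.
  by apply: rho_sat_ext rs => k ltk; rewrite xi'E ?xi1E //; lia.
exists xi' => //; rewrite /aexp_form; rewrite !models_and; rewrite models_conj ms.
have Bu : block n xi' (r + r) = w.
  by rewrite -xi1u; apply: block_ext => k ltk; apply: xi'E; lia.
have Bv : block n xi' (r + r + n) = z.
  by rewrite -xi1v; apply: block_ext => k ltk; apply: xi'E; lia.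
apply/andP; split; last first.
  by rewrite (gt_form_models _ _ rs') // /lin_val /= lin_sum mul1r addr0 Bv.
apply/flag_rows_sat; split=> [i|]; last apply/tmpl_rows_sat; last split=> // i.
  by have := rs' (y i); have := argN i; have := fin (y i);
    case: (rho (y i)) => [c| |] //= _ _ [].
rewrite /= Bu; have := rs' (y i); have := argN i; have := fin (y i); have := wg i.
by case: (rho (y i)) => [c| |] //= + _ _ [-> _].
Qed.

Lemma aexp_nextE a b : aexp_next a b = (b + size (aexp_pos a))%N.
Proof. by case: a => [c|s j y] /=; rewrite ?addn0 ?next_boolE. Qed.

Lemma rhs_form_models M e b D x :
  models M (rhs_form e b D x) <->
  (forall l : 'I_(size e), bool_val M (b + select_var e l)%N ->
     models M (aexp_form (tnth (in_tuple e) l) (b + select_var e l).+1 x)) /\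
  (models M D \/ exists l : 'I_(size e), bool_val M (b + select_var e l)%N).
Proof.
have H : models M (rhs_form e b D x) <->
  (forall l, (l < size e)%N -> bool_val M (b + select_var e l)%N ->
     models M (aexp_form (nth (Const 0%E) e l) (b + select_var e l).+1 x)) /\
  (models M D \/ exists2 l, (l < size e)%N & bool_val M (b + select_var e l)%N).
  elim: e b D => [|a e IH] b D.
    by split=> [?|[_ [//|[]//]]]; split=> //; left.
  rewrite /rhs_form -/rhs_form models_and; set p := aexp_form _ _ _.
  have sel l : (b + select_var (a :: e) l.+1 =
      aexp_next a b.+1 + select_var e l)%N.
    by rewrite aexp_nextE /select_var /= !addSn addnS addnA.
  have sel0 : (b + select_var (a :: e) 0 = b)%N by rewrite addn0.
  split.
    case/andP=> Hb /IH[He HD]; split.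
      case=> [_|l ltl]; last by rewrite sel; apply: He.
      by rewrite sel0 => bb; move: Hb; rewrite /= bb.
    case: HD => [/orP[bb|]|[l ltl bl]]; [|by left|].
      by right; exists 0%N => //; rewrite sel0.
    by right; exists l.+1 => //; rewrite sel.
  case=> He HD; apply/andP; split.
    rewrite /= -implybE; apply/implyP => bb.
    by have := He 0%N isT; rewrite sel0; apply.
  apply/IH; split=> [l ltl bl|].
    by have := He l.+1 ltl; rewrite sel; apply.
  case: HD => [mD|[[|l] ltl]]; first by left; rewrite /= mD orbT.
    by rewrite sel0 => bb; left; rewrite /= bb.
  by rewrite sel => bl; right; exists l.
rewrite H; split=> -[He HD]; split.
- by move=> l; rewrite (tnth_nth (Const 0%E)); apply: He.
- by case: HD => [|[l ltl bl]]; [left|right; exists (Ordinal ltl)].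
- by move=> l ltl; have := He (Ordinal ltl); rewrite (tnth_nth (Const 0%E)).
- by case: HD => [|[l bl]]; [left|right; exists l].
Qed.

(** Some selection variable is true, so the default [b] is never returned; if several are true, all
    their formulas hold and any pick is good. *)
Lemma sat_form_sound (E : system R n m r) rho x M (b : strat_rhs (E x)) :
  (forall z, (rho z < +oo)%E) ->
  models M (sat_form E rho x) ->
  (rho x < aexp_val T
     (rhs_app (odflt b (strat_of_bools (E x) (bool_val M)))) rho)%E.
Proof.
move=> fin; rewrite /sat_form /= models_conj => /andP[/rho_rows_sat rs].
move=> /rhs_form_models[He [//|[l0 bl0]]].
rewrite /strat_of_bools; case: pickP => [l bl|/(_ l0)]; last by rewrite bl0.
rewrite /= /rhs_app /=.
rewrite (@aexp_app_strat _ _ _ _ _ (fun p => bool_val M (pos_var l p))).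
have := He l bl; case: M rs {He bl bl0} => xi B rs.
by apply: aexp_form_sound => //= p pP.
Qed.

Lemma select_var_lt (e : rhs R n m r) k l : (k < l)%N -> (l <= size e)%N ->
  (select_var e k + (size (aexp_pos (nth (Const 0%E) e k))).+1 <= select_var e l)%N.
Proof.
elim: e k l => [|a e IH] [|k] [|l] //=.
  by move=> _ _; rewrite /select_var /= add0n leq_addr.
by move=> lt le; have := IH k l lt le; rewrite /select_var /= -addnA leq_add2l.
Qed.

Lemma sat_form_complete (E : system R n m r) rho x :
  (forall z, (rho z < +oo)%E) ->
  (rho x < rhs_val T (E x) rho)%E ->
  exists M, models M (sat_form E rho x).
Proof.
move=> fin /rhs_app_gt[sg lt].
pose l := tag sg; pose e := E x; pose a := tnth (in_tuple e) l.
pose g : seq bool -> bool := strat_fun (tagged sg).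
(* True only inside the block of disjunct [l], so the guards switch all other disjuncts off. *)
pose B k := (select_var e l <= k <= select_var e l + size (aexp_pos a))%N &&
  ((k == select_var e l) ||
   g (nth [::] (aexp_pos a) (k - (select_var e l).+1)%N)).
have Bl : B (select_var e l) by rewrite /B leqnn leq_addr eqxx.
have ag : agree B (select_var e l).+1 (aexp_pos a) g.
  move=> p pP; rewrite /B addKn nth_index // addSn ltnW ?ltnS ?leq_addr //=.
  rewrite -addnS leq_add2l index_mem pP /=.
  by rewrite gtn_eqF // addnS ltnS leq_addr.
have Bne l' : (l' < size e)%N -> B (select_var e l') -> l' = l :> nat.
  move=> ltl'; have [lt'|lt'|//] := ltngtP l' l.
    move: (select_var_lt lt' (ltnW (ltn_ord l))) => H /andP[/andP[le _] _].
    by have := leq_trans H le; rewrite addnS ltnNge leq_addr.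
  move: (select_var_lt lt' (ltnW ltl')).
  rewrite -(tnth_nth _ (in_tuple e)) -/a => H /andP[/andP[_ le] _].
  by have := leq_trans H le; rewrite addnS ltnn.
pose xi k := if insub k is Some z then fine (rho z) else
  if insub (k - r)%N is Some z then (if rho z is _%:E then 1 else 0) else 0.
have rs : rho_sat xi rho.
  move=> z; rewrite /xi valK insubF; last by rewrite ltnNge leq_addr.
  by rewrite addKn valK; case: (rho z).
have [xi' rs' ms] := aexp_form_complete rs fin ag lt.
exists (Valuation xi' B); rewrite /sat_form; rewrite models_and.
rewrite models_conj; apply/andP; split; first by apply/rho_rows_sat.
apply/rhs_form_models; split; last by right; exists l; rewrite add0n.
move=> l'; rewrite add0n => /= /(Bne _ (ltn_ord l'))/val_inj ->.
exact: ms.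
Qed.

End SatFormula.

(** * The linear program *)

Section LinearProgram.
Variables (R : realType) (n m r : nat) (T : 'M[R]_(m, n)).
Implicit Types (rho : assignment R r) (xi : nat -> R) (a : aexp R n m r).

Definition lp_state : Type := (nat * (seq (R * nat) * seq (lrow R)))%type.

(* The state consists of the first unused variable, the objective and the rows
   of the linear program constructed so far. *)
Definition lp_aexp a (x : nat) (st : lp_state) : lp_state :=
  match a with
  | Const c%:E => (st.1, ((1, x) :: st.2.1, ([:: (1, x)], c) :: st.2.2))
  | Const _ => st
  | Abs s j y =>
      (next_real s (st.1 + n + n),
       ((1, x) :: st.2.1,
        ((1, x) :: lin (-1) (T j) (st.1 + n), 0) ::
        tmpl_rows T y st.1 (enum 'I_m)
          (stmt_rows s st.1 (st.1 + n) (st.1 + n + n) st.2.2)))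
  end.

Definition lp_system (S : 'I_r -> aexp R n m r) : lp R :=
  let st := foldl (fun st x => lp_aexp (S x) x st) (r, ([::], [::])) (enum 'I_r) in
  Lp st.1 st.2.1 st.2.2.

Definition seq_aexp a : bool := if a is Abs s _ _ then sequential s else true.

(** What is left of the rows of one equation when its auxiliary variables are projected out. *)
Definition lp_con xi a (x : nat) : Prop :=
  match a with
  | Const c => if c is d%:E then xi x <= d else True
  | Abs s j y => exists u v, [/\ forall i, (T *m u) i 0 <= xi (y i),
      sem s [set u] v & xi x <= (T *m v) j 0]
  end.

(** An infinite constant yields no row; its variable is unbounded and must stay out of the
    objective. *)
Definition in_obj a : bool :=
  match a with Const c => c \is a fin_num | Abs _ _ _ => true end.

Definition rows_dep (f : nat) (rows : seq (lrow R)) : Prop :=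
  forall xi xi', (forall k, (k < f)%N -> xi k = xi' k) ->
    all (row_sat xi) rows = all (row_sat xi') rows.

Lemma lp_aexp_sound xi a x st : seq_aexp a ->
  all (row_sat xi) (lp_aexp a x st).2.2 -> lp_con xi a x /\ all (row_sat xi) st.2.2.
Proof.
case: a => [[c| |]|s j y] //=.
  by move=> _; rewrite {1}/row_sat big_seq1 /= mul1r => /andP[].
move=> sq /andP[]; rewrite {1}/row_sat big_cons /= lin_sum => le.
move=> /tmpl_rows_sat[tm].
move=> /(@stmt_rows_sat _ _ _ _ _ 0%N _ _ _ (fun=> false) sq)[ms ->]; split=> //.
exists (block n xi st.1), (block n xi (st.1 + n)); split=> //; last by lra.
rewrite -(stmt_app_sequential (fun=> false) sq).
by apply: stmt_form_sound ms; rewrite sequential_choice_pos.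
Qed.

Lemma lp_aexp_complete xi a x st : seq_aexp a -> (x < st.1)%N -> (r <= st.1)%N ->
  rows_dep st.1 st.2.2 -> all (row_sat xi) st.2.2 -> lp_con xi a x ->
  [/\ (st.1 <= (lp_aexp a x st).1)%N,
      rows_dep (lp_aexp a x st).1 (lp_aexp a x st).2.2 &
      exists2 xi', forall k, (k < st.1)%N -> xi' k = xi k &
        all (row_sat xi') (lp_aexp a x st).2.2].
Proof.
case: st => f [obj rows] /=; case: a => [[c| |]|s j y] /=.
- move=> _ ltx lef dep sat con; split=> //.
    by move=> xi1 xi2 eq /=; rewrite (dep xi1 xi2) // /row_sat !big_seq1 /= eq.
  by exists xi => //=; rewrite sat andbT /row_sat big_seq1 /= mul1r.
- by move=> _ ltx lef dep sat _; split=> //; exists xi.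
- by move=> _ ltx lef dep sat _; split=> //; exists xi.
move=> sq ltx lef dep sat [u [v [uy suv xv]]].
have le := leq_next_real s (f + n + n).
split; first by lia.
  move=> xi1 xi2 eq /=; congr (_ && _).
    rewrite /row_sat !big_cons /= !lin_sum eq; last by lia.
    by rewrite (@block_ext _ n xi1 xi2) // => k ltk; apply: eq; lia.
  have Bu : block n xi1 f = block n xi2 f.
    by apply: block_ext => k ltk; apply: eq; lia.
  have Ey i : xi1 (y i) = xi2 (y i).
    by apply: eq; have := ltn_ord (y i); lia.
  have E : models (Valuation xi1 (fun=> false))
        (stmt_form s f (f + n) 0 (f + n + n)) =
      models (Valuation xi2 (fun=> false)) (stmt_form s f (f + n) 0 (f + n + n)).
    by apply: stmt_form_dep => //; lia.
  have D : all (row_sat xi1) rows = all (row_sat xi2) rows.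
    by apply: dep => k ltk; apply: eq; lia.
  have S xi0 := @stmt_rows_sat _ _ s f (f + n) 0%N (f + n + n) rows xi0
    (fun=> false) sq.
  apply/idP/idP=> /tmpl_rows_sat[tm] /S[ms ra]; apply/tmpl_rows_sat.
    by split=> [i|]; [rewrite -Bu -Ey|apply/S; rewrite -E -D].
  by split=> [i|]; [rewrite Bu Ey|apply/S; rewrite E D].
pose xi1 k := if (k < f)%N then xi k else
  if insub (k - f)%N is Some i then u i 0 else
  if insub (k - (f + n))%N is Some i then v i 0 else 0.
have xi1E k : (k < f)%N -> xi1 k = xi k by rewrite /xi1 => ->.
have xi1u : block n xi1 f = u.
  by apply/colP => i; rewrite mxE /xi1 ltnNge leq_addr addKn valK.
have xi1v : block n xi1 (f + n) = v.
  apply/colP => i; rewrite mxE /xi1 -addnA ltnNge leq_addr addKn.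
  by rewrite insubF ?addnA ?addKn ?valK //; apply/negbTE; rewrite -leqNgt leq_addr.
have [||||xi' xi'E ms] := @stmt_form_complete R n s f (f + n) 0
    (f + n + n) (fun=> false) xi1 (fun=> false).
- by rewrite sequential_choice_pos.
- lia.
- lia.
- by rewrite xi1u xi1v stmt_app_sequential.
have Bu : block n xi' f = u.
  by rewrite -xi1u; apply: block_ext => k ltk; apply: xi'E; lia.
have Bv : block n xi' (f + n) = v.
  by rewrite -xi1v; apply: block_ext => k ltk; apply: xi'E; lia.
have xi'f k : (k < f)%N -> xi' k = xi k.
  by move=> ltk; rewrite xi'E ?xi1E //; lia.
exists xi' => //=; apply/andP; split.
  by rewrite /row_sat big_cons /= lin_sum Bv xi'f //; lra.
apply/tmpl_rows_sat; split=> [i|].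
  by rewrite Bu xi'f //; have := ltn_ord (y i); lia.
by apply/stmt_rows_sat => //; split; [exact: ms|rewrite (dep xi' xi)].
Qed.

Lemma lp_aexp_obj xi a x st :
  \sum_(cv <- (lp_aexp a x st).2.1) cv.1 * xi cv.2 =
  (if in_obj a then xi x else 0) + \sum_(cv <- st.2.1) cv.1 * xi cv.2.
Proof.
by case: a => [[c| |]|s j y] /=; rewrite ?add0r // big_cons /= mul1r.
Qed.

Section Program.
Variable S : 'I_r -> aexp R n m r.
Hypothesis S_seq : forall x, seq_aexp (S x).

Let run_lp st s := foldl (fun st (x : 'I_r) => lp_aexp (S x) x st) st s.

Lemma lp_system_sound xi (x : 'I_r) :
  all (row_sat xi) (lp_rows (lp_system S)) -> lp_con xi (S x) x.
Proof.
rewrite /= -/(run_lp _ _).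
have : x \in enum 'I_r by rewrite mem_enum.
suff H st s : all (row_sat xi) (run_lp st s).2.2 ->
    all (row_sat xi) st.2.2 /\ (forall x, x \in s -> lp_con xi (S x) x).
  by move=> xs /H[_]; apply.
elim: s st => [|y s IH] st //= /IH[] /(lp_aexp_sound (S_seq y))[con ->] Hs.
by split=> // z; rewrite inE => /orP[/eqP ->|/Hs].
Qed.

Lemma lp_system_complete xi : (forall x : 'I_r, lp_con xi (S x) x) ->
  exists xi', [/\ forall x : 'I_r, xi' x = xi x,
    all (row_sat xi') (lp_rows (lp_system S)),
    rows_dep (lp_dim (lp_system S)) (lp_rows (lp_system S)) &
    (r <= lp_dim (lp_system S))%N].
Proof.
rewrite /= -/(run_lp _ _) => con.
suff H st s xi1 : (r <= st.1)%N -> rows_dep st.1 st.2.2 ->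
    all (row_sat xi1) st.2.2 -> (forall x : 'I_r, xi1 x = xi x) ->
    exists xi', [/\ forall x : 'I_r, xi' x = xi x,
      all (row_sat xi') (run_lp st s).2.2,
      rows_dep (run_lp st s).1 (run_lp st s).2.2 & (r <= (run_lp st s).1)%N].
  by apply: (H _ _ xi) => //= ? ? _.
elim: s st xi1 => [|y s IH] st xi1 lef dep sat eq /=; first by exists xi1.
have con1 : lp_con xi1 (S y) y.
  have := con y; case: (S y) => [[c| |]|s0 j y0] //=; rewrite eq // .
  by case=> u [v [H1 H2 H3]]; exists u, v; split=> // i; rewrite eq.
have [le dep' [xi2 xi2E sat2]] :=
  lp_aexp_complete (S_seq y) (leq_trans (ltn_ord y) lef) lef dep sat con1.
apply: (IH _ xi2) => //; first exact: leq_trans lef le.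
by move=> x; rewrite xi2E ?eq //; apply: leq_trans (ltn_ord x) lef.
Qed.

Lemma lp_system_obj xi :
  \sum_(cv <- lp_obj (lp_system S)) cv.1 * xi cv.2 =
  \sum_(x | in_obj (S x)) xi (val x).
Proof.
have -> : \sum_(x | in_obj (S x)) xi (val x) =
    \sum_(x <- enum 'I_r) (if in_obj (S x) then xi (val x) else 0).
  by rewrite big_mkcond big_enum.
rewrite /= -/(run_lp _ _).
suff H st s : \sum_(cv <- (run_lp st s).2.1) cv.1 * xi cv.2 =
    \sum_(x <- s) (if in_obj (S x) then xi (val x) else 0) +
    \sum_(cv <- st.2.1) cv.1 * xi cv.2.
  by rewrite H /= big_nil addr0.
elim: s st => [|y s IH] st /=; first by rewrite big_nil add0r.
by rewrite IH lp_aexp_obj big_cons; lra.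
Qed.

End Program.

Lemma sparse_row_mul (N : nat) (b : seq (R * nat)) (z : 'cV[R]_N) :
  (sparse_row N b *m z) 0 0 = \sum_(cv <- b) cv.1 * Defs.coord z cv.2.
Proof.
rewrite mxE; under eq_bigr => j _ do rewrite mxE mulr_suml.
rewrite (exchange_big_dep xpredT) //=; apply: eq_bigr => cv _.
rewrite /Defs.coord; case: insubP => [i _ <-|].
  by rewrite (big_pred1 i).
(* Out of range, [coord] is 0 and [sparse_row] drops the entry. *)
move=> ge; rewrite mulr0 big1 // => j /eqP eq.
by move: ge; rewrite eq ltn_ord.
Qed.

Lemma lp_feasibleP (L : lp R) (z : 'cV[R]_(lp_dim L)) :
  lp_feasible z <-> all (row_sat (Defs.coord z)) (lp_rows L).
Proof.
have E i : ((lp_A L *m z) i 0 <= lp_b L i 0) =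
    row_sat (Defs.coord z) (tnth (in_tuple (lp_rows L)) i).
  rewrite /row_sat -sparse_row_mul [lp_b _ _ _]mxE; congr (_ <= _).
  by rewrite !mxE; apply: eq_bigr => j _; rewrite mxE.
have P := @all_tnthP _ _ (row_sat (Defs.coord z)) (in_tuple (lp_rows L)).
by split=> [H|/P H i]; [apply/P => i; rewrite -E|rewrite E; apply: H].
Qed.

End LinearProgram.

(** * The value after a step as the optimum of the linear program *)

Section StepProgram.
Variables (R : realType) (n m r : nat) (T : 'M[R]_(m, n)).
Variables (E : system R n m r) (mu : assignment R r).
Hypotheses (mu_sol : solution T E mu) (mu_fin : forall x, (mu x < +oo)%E).
Variables (sg sg' : strategy (or_bot E)) (rho rho' : assignment R r).
Hypotheses (inv_sg : strat_inv T mu sg rho) (nsol : ~ solution T (or_bot E) rho).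
Hypothesis (imp : improvement T rho sg sg').
Hypothesis (least : least_solution_ge T (sys_app sg') rho rho').

Let S x := rhs_app (sg' x).
Let L := lp_system T S.

Let S_seq x : seq_aexp (S x).
Proof.
rewrite /S /rhs_app; move: (strat_fun _) => g.
by case: (tnth _ _) => //= *; apply: sequential_stmt_app.
Qed.

Let strat_inv' : strat_inv T mu sg' rho'.
Proof. exact: inv_step inv_sg nsol imp least. Qed.

Let fix' x : rho' x = aexp_val T (S x) rho'. Proof. by case: strat_inv'. Qed.

Let gtNy x : S x <> Const -oo%E -> (-oo < rho' x)%E.
Proof.
move=> ne; have [_ _ /(_ x)[eq|//]] := strat_inv'.
by move: ne; rewrite /S eq rhs_app_init.
Qed.

Let in_objP x : in_obj (S x) = (-oo < rho' x)%E.
Proof.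
have := @gtNy x; have := inv_fin mu_fin strat_inv' x; have := fix' x.
case: (S x) => [c|s j y] /= eq lt gt; last by rewrite gt.
by move: lt; rewrite eq; case: (c) => // d _; rewrite ltNyr.
Qed.

Let rho'E x : (-oo < rho' x)%E -> rho' x = (fine (rho' x))%:E.
Proof.
by move=> gt; rewrite fineK // fin_numE -ltey -ltNye gt (inv_fin mu_fin strat_inv').
Qed.

(** A feasible point is a presolution on the finite variables, and [rho'] is the greatest one. *)
Let feasible_le (z : 'cV[R]_(lp_dim L)) x :
  lp_feasible z -> in_obj (S x) -> Defs.coord z x <= fine (rho' x).
Proof.
move=> /lp_feasibleP feas; rewrite in_objP => gt.
rewrite -lee_fin -rho'E //.
apply: (greatest_presolution mu_fin (nu := fun x => Defs.coord z x)
  strat_inv') gt => {}x gt.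
have := lp_system_sound S_seq x feas; move: gt; rewrite -in_objP -/(S x).
case: (S x) => [[c| |]|s j y] //= _; case=> u [v [uy suv xv]].
rewrite /abs_sem alphaE.
have : ((Defs.coord z x)%:E <= ((T *m v) j 0)%:E)%E by rewrite lee_fin.
move/le_trans; apply; apply: ereal_sup_ubound; exists v => //.
by apply/sem_point; exists u => // i; rewrite /asg_real lee_fin.
Qed.

(** Attainment of the suprema is essential here: the auxiliary variables hold runs that reach the
    values of [rho'] exactly. *)
Let optimum : exists2 z : 'cV[R]_(lp_dim L), lp_feasible z &
  forall x, in_obj (S x) -> Defs.coord z x = fine (rho' x).
Proof.
pose xi k := if insub k is Some x then fine (rho' x) else 0.
have xiE (x : 'I_r) : xi x = fine (rho' x) by rewrite /xi valK.
have con x : lp_con T xi (S x) x.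
  have := fix' x; have := @gtNy x; have := @aexp_app_attained R n m r T.
  have := S_seq x; rewrite /lp_con xiE.
  case: (S x) => [[c| |]|s j y] sq att gt eq //; first by rewrite eq.
  have {}gt := gt (fun e => match e with erefl => I end).
  have := att s (fun=> false) j y rho' (fine (rho' x)).
  rewrite stmt_app_sequential // -rho'E // -eq.
  case=> [i|//|v /sem_point[u ug suv] le]; first exact: inv_fin strat_inv' _.
  exists u, v; split=> // i; rewrite xiE -lee_fin -rho'E //.
  by apply: lt_le_trans (ug i); rewrite ltNyr.
have [xi' [xi'E sat dep le]] := lp_system_complete S_seq con.
pose z : 'cV[R]_(lp_dim L) := \col_k xi' k.
have zE k : (k < lp_dim L)%N -> Defs.coord z k = xi' k.
  by move=> ltk; rewrite /Defs.coord insubT mxE.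
exists z; first by apply/lp_feasibleP; rewrite (dep _ xi').
by move=> x _; rewrite zE ?xi'E ?xiE //; apply: leq_trans (ltn_ord x) le.
Qed.

Let objE (z : 'cV[R]_(lp_dim L)) :
  (lp_c L *m z) 0 0 = \sum_(x | in_obj (S x)) Defs.coord z x.
Proof. by rewrite sparse_row_mul lp_system_obj. Qed.

Lemma lp_system_has_optimum : exists z, @lp_optimal R L z.
Proof.
have [z feas zE] := optimum; exists z; split=> // y feasy.
by rewrite !objE; apply: ler_sum => x Sx; rewrite zE //; apply: feasible_le.
Qed.

(** All coordinates in the objective are bounded by [rho'] and reach it simultaneously, so a maximal
    sum forces equality in each of them. *)
Lemma lp_system_optimal z : @lp_optimal R L z ->
  least_solution_ge T (sys_app sg') rho (asg_of_lp sg' z).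
Proof.
case=> feas opt; suff -> : asg_of_lp sg' z = rho' by [].
have [z0 feas0 z0E] := optimum.
have eq x : in_obj (S x) -> Defs.coord z x = fine (rho' x).
  move=> Sx; apply/eqP; rewrite eq_le feasible_le //= leNgt; apply/negP => lt.
  have := opt _ feas0; rewrite !objE leNgt => /negP; apply.
  rewrite [ltLHS](bigD1 x) // [ltRHS](bigD1 x) //= ltr_leD ?z0E //.
  by apply: ler_sum => y /andP[Sy _]; rewrite (z0E y) //; apply: feasible_le.
apply/funext => x; rewrite /asg_of_lp -/(S x).
have := eq x; have := in_objP x; have := fix' x; have := rho'E (x := x).
case: (S x) => [[c| |]|s j y] /= re fx Ix eqx.
- by rewrite eqx // -re // -Ix.
- by have := inv_fin mu_fin strat_inv' x; rewrite fx.
- by rewrite fx.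
- by rewrite eqx // -re // -Ix.
Qed.

End StepProgram.

(** * Linear-time programs *)

(* Every function takes one right-nested tuple, whose components are listed in
   the comment above its code; [fld k d] and [last_fld k d] are a component and
   the last component of the tuple bound to the de Bruijn variable [d].  The
   lists of the column indices that come with the matrices are walked through
   along with the rows, so that no counter is needed there. *)
Definition fld (k d : nat) : Defs.code := CFst (iter k CSnd (CVar d)).
Definition last_fld (k d : nat) : Defs.code := iter k CSnd (CVar d).
Definition minus_one : Defs.code := COpp (CReal 1).
Definition c_terms1 (a v : Defs.code) : Defs.code := CPair (CPair a v) (CNat 0).
Definition c_true : Defs.code := CNat 0.
Definition c_bool (v : Defs.code) : Defs.code := CPair (CNat 0) v.
Definition c_not (p : Defs.code) : Defs.code := CPair (CNat 3) p.
Definition c_and (p q : Defs.code) : Defs.code := CPair (CNat 4) (CPair p q).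
Definition c_or (p q : Defs.code) : Defs.code := CPair (CNat 5) (CPair p q).
Definition c_le (t u : Defs.code) : Defs.code := CPair (CNat 1) (CPair t u).
Definition c_lt (t u : Defs.code) : Defs.code := CPair (CNat 2) (CPair t u).
Definition c_gt (r x t : Defs.code) : Defs.code :=
  c_or (c_le (CPair (c_terms1 (CReal 1) (CAddn r x)) (CReal 0))
             (CPair (CNat 0) (CReal 0)))
       (c_lt (CPair (c_terms1 (CReal 1) x) (CReal 0)) t).

Notation "<| a ; .. ; b ; c |>" := (CPair a .. (CPair b c) ..) (at level 0).

Definition len_code : Defs.code :=
  CIfPair (CVar 0) (CAddn (CNat 1) (CCall 1 (CSnd (CVar 0)))) (CNat 0).

(* cols, coefficients, base variable, factor *)
Definition lin_code : Defs.code :=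
  CIfPair (fld 0 0)
    (CPair (CPair (CMul (last_fld 3 0) (CFst (fld 1 0)))
                  (CAddn (fld 2 0) (CFst (fld 0 0))))
       (CCall 2 <| CSnd (fld 0 0); CSnd (fld 1 0); fld 2 0; last_fld 3 0 |>))
    (CNat 0).

(* list, current index, wanted index *)
Definition nth_code : Defs.code :=
  CIfEqn (fld 1 0) (last_fld 2 0) (CFst (fld 0 0))
    (CCall 3 <| CSnd (fld 0 0); CAddn (CNat 1) (fld 1 0); last_fld 2 0 |>).

(* cols, row indices, rows, constants, input block, output block, acc *)
Definition assign_code : Defs.code :=
  CIfPair (fld 1 0)
    (CPair
      (CPair (CPair (CPair minus_one (CAddn (fld 5 0) (CFst (fld 1 0))))
                (CCall 2 <| fld 0 0; CFst (fld 2 0); fld 4 0; CReal 1 |>))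
         (COpp (CFst (fld 3 0))))
    (CPair
      (CPair (CPair (CPair (CReal 1) (CAddn (fld 5 0) (CFst (fld 1 0))))
                (CCall 2 <| fld 0 0; CFst (fld 2 0); fld 4 0; minus_one |>))
         (CFst (fld 3 0)))
      (CCall 4 <| fld 0 0; CSnd (fld 1 0); CSnd (fld 2 0); CSnd (fld 3 0);
                  fld 4 0; fld 5 0; last_fld 6 0 |>)))
    (last_fld 6 0).

(* cols, rows, constants, input block, acc *)
Definition guard_code : Defs.code :=
  CIfPair (fld 1 0)
    (CPair
      (CPair (CCall 2 <| fld 0 0; CFst (fld 1 0); fld 3 0; CReal 1 |>)
         (CFst (fld 2 0)))
      (CCall 5 <| fld 0 0; CSnd (fld 1 0); CSnd (fld 2 0); fld 3 0;
                  last_fld 4 0 |>))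
    (last_fld 4 0).

(* cols, input block, output block, acc *)
Definition copy_code : Defs.code :=
  CIfPair (fld 0 0)
    (CPair
      (CPair (CPair (CPair (CReal 1) (CAddn (fld 1 0) (CFst (fld 0 0))))
                (c_terms1 minus_one (CAddn (fld 2 0) (CFst (fld 0 0)))))
         (CReal 0))
    (CPair
      (CPair (CPair (CPair minus_one (CAddn (fld 1 0) (CFst (fld 0 0))))
                (c_terms1 (CReal 1) (CAddn (fld 2 0) (CFst (fld 0 0)))))
         (CReal 0))
      (CCall 6 <| CSnd (fld 0 0); fld 1 0; fld 2 0; last_fld 3 0 |>)))
    (last_fld 3 0).

(* elementary statement, input block, output block, acc *)
Definition elem_code : Defs.code :=
  let mx := CFst (CSnd (fld 0 0)) in
  let b := CSnd (CSnd (fld 0 0)) in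
  CIfEqn (CFst (fld 0 0)) (CNat 0)
    (CCall 4 <| CFst mx; CFst mx; CSnd mx; b; fld 1 0; fld 2 0; last_fld 3 0 |>)
    (CCall 6 <| CFst mx; fld 1 0; fld 2 0;
                CCall 5 <| CFst mx; CSnd mx; b; fld 1 0; last_fld 3 0 |> |>).

Definition conj_code : Defs.code :=
  CIfPair (CVar 0)
    (c_and (c_le (CPair (CFst (fld 0 0)) (CReal 0))
                 (CPair (CNat 0) (CSnd (fld 0 0))))
           (CCall 8 (CSnd (CVar 0))))
    c_true.

(* cols, rows of the template, arguments, block, acc *)
Definition tmpl_code : Defs.code :=
  CIfPair (fld 1 0)
    (CPair
      (CPair (CPair (CPair minus_one (CFst (fld 2 0)))
                (CCall 2 <| fld 0 0; CFst (fld 1 0); fld 3 0; CReal 1 |>))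
         (CReal 0))
      (CCall 9 <| fld 0 0; CSnd (fld 1 0); CSnd (fld 2 0); fld 3 0;
                  last_fld 4 0 |>))
    (last_fld 4 0).

(* arguments, number of variables of the system, acc *)
Definition flag_code : Defs.code :=
  CIfPair (fld 0 0)
    (CPair
      (CPair (c_terms1 minus_one (CAddn (fld 1 0) (CFst (fld 0 0)))) minus_one)
      (CCall 10 <| CSnd (fld 0 0); fld 1 0; last_fld 2 0 |>))
    (last_fld 2 0).

(* values, current variable, number of variables *)
Definition rho_code : Defs.code :=
  CIfPair (fld 0 0)
    (CIfPair (CFst (fld 0 0))
      (CPair (CPair (c_terms1 (CReal 1) (fld 1 0)) (CSnd (CFst (fld 0 0))))
      (CPair (CPair (c_terms1 minus_one (fld 1 0))
                (COpp (CSnd (CFst (fld 0 0)))))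
      (CPair (CPair (c_terms1 minus_one (CAddn (last_fld 2 0) (fld 1 0))) minus_one)
        (CCall 11 <| CSnd (fld 0 0); CAddn (CNat 1) (fld 1 0); last_fld 2 0 |>))))
      (CPair (CPair (c_terms1 (CReal 1) (CAddn (last_fld 2 0) (fld 1 0))) (CReal 0))
        (CCall 11 <| CSnd (fld 0 0); CAddn (CNat 1) (fld 1 0); last_fld 2 0 |>)))
    (CNat 0).

(* statement, n, input block, output block, Boolean counter, real counter *)
Definition stmt_code : Defs.code :=
  let tag := CFst (fld 0 0) in
  let s0 := CFst (CSnd (fld 0 0)) in
  let s1 := CSnd (CSnd (fld 0 1)) in
  let b0 := CFst (CSnd (CVar 0)) in
  let f0 := CSnd (CSnd (CVar 0)) in
  CIfEqn tag (CNat 2)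
    (CLet (CCall 12 <| s0; fld 1 0; fld 2 0; last_fld 5 0; fld 4 0;
                       CAddn (last_fld 5 0) (fld 1 0) |>)
    (CLet (CCall 12 <| s1; fld 1 1; last_fld 5 1; fld 3 1; b0; f0 |>)
      (CPair (c_and (CFst (CVar 1)) (CFst (CVar 0))) (CSnd (CVar 0)))))
  (CIfEqn tag (CNat 3)
    (CLet (CCall 12 <| s0; fld 1 0; fld 2 0; fld 3 0;
                       CAddn (CNat 1) (fld 4 0); last_fld 5 0 |>)
    (CLet (CCall 12 <| s1; fld 1 1; fld 2 1; fld 3 1; b0; f0 |>)
      (CPair (c_and (c_or (c_bool (fld 4 2)) (CFst (CVar 1)))
                    (c_or (c_not (c_bool (fld 4 2))) (CFst (CVar 0))))
         (CSnd (CVar 0)))))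
    (CPair (CCall 8 (CCall 7 <| fld 0 0; fld 2 0; fld 3 0; CNat 0 |>))
       (CPair (fld 4 0) (last_fld 5 0)))).

(* disjunct, Boolean counter, number of variables, variable *)
Definition aexp_code : Defs.code :=
  let cols d := CFst (CSnd (CFst (CSnd (fld 0 d)))) in
  let rows d := CSnd (CSnd (CFst (CSnd (fld 0 d)))) in
  let j d := CFst (CSnd (CSnd (fld 0 d))) in
  let ys d := CSnd (CSnd (CSnd (fld 0 d))) in
  let rr d := CAddn (fld 2 d) (fld 2 d) in
  CIfEqn (CFst (fld 0 0)) (CNat 0)
    (CPair
      (CIfPair (CSnd (fld 0 0))
        (c_gt (fld 2 0) (last_fld 3 0) (CPair (CNat 0) (CSnd (CSnd (fld 0 0)))))
        (CIfEqn (CSnd (fld 0 0)) (CNat 0) c_true (c_not c_true)))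
      (CPair (fld 1 0) (CNat 0)))
    (CLet (CCall 1 (cols 0))
    (CLet (CCall 12 <| CFst (CFst (CSnd (fld 0 1))); CVar 0; rr 1;
                       CAddn (rr 1) (CVar 0); fld 1 1;
                       CAddn (CAddn (rr 1) (CVar 0)) (CVar 0) |>)
      (CPair
        (c_and
          (CCall 8 (CCall 10 <| ys 2; fld 2 2;
             CCall 9 <| cols 2; rows 2; ys 2; rr 2; CNat 0 |> |>))
          (c_and (CFst (CVar 0))
            (c_gt (fld 2 2) (last_fld 3 2)
              (CPair (CCall 2 <| cols 2; CCall 3 <| rows 2; CNat 0; j 2 |>;
                                 CAddn (rr 2) (CVar 1); CReal 1 |>)
                 (CReal 0)))))
        (CSnd (CVar 0))))).

(* disjuncts, Boolean counter, disjunction, number of variables, variable *)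
Definition rhs_code : Defs.code :=
  CIfPair (fld 0 0)
    (CLet (CCall 13 <| CFst (fld 0 0); CAddn (CNat 1) (fld 1 0); fld 3 0;
                       last_fld 4 0 |>)
      (c_and (c_or (c_not (c_bool (fld 1 1))) (CFst (CVar 0)))
        (CCall 14 <| CSnd (fld 0 1); CFst (CSnd (CVar 0));
                     c_or (c_bool (fld 1 1)) (fld 2 1); fld 3 1; last_fld 4 1 |>)))
    (fld 2 0).

(* system, assignment, variable *)
Definition sat_code : Defs.code :=
  CLet (CCall 1 (fld 1 0))
    (c_and (CCall 8 (CCall 11 <| fld 1 1; CNat 0; CVar 0 |>))
      (CCall 14 <| CCall 3 <| fld 0 1; CNat 0; last_fld 2 1 |>; CNat 0;
                   c_not c_true; CVar 0; last_fld 2 1 |>)).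

(* statement, strategy, n, input block, output block, real counter, acc *)
Definition lp_stmt_code : Defs.code :=
  let tag := CFst (fld 0 0) in
  let s0 := CFst (CSnd (fld 0 0)) in
  let s1 d := CSnd (CSnd (fld 0 d)) in
  CIfEqn tag (CNat 2)
    (CLet (CCall 16 <| s0; CFst (fld 1 0); fld 2 0; fld 3 0; fld 5 0;
                       CAddn (fld 5 0) (fld 2 0); last_fld 6 0 |>)
      (CCall 16 <| s1 1; CSnd (fld 1 1); fld 2 1; fld 5 1; fld 4 1;
                   CSnd (CVar 0); CFst (CVar 0) |>))
  (CIfEqn tag (CNat 3)
    (CIfEqn (CFst (fld 1 0)) (CNat 1)
      (CCall 16 <| s1 0; CSnd (CSnd (fld 1 0)); fld 2 0; fld 3 0; fld 4 0;
                   fld 5 0; last_fld 6 0 |>)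
      (CCall 16 <| s0; CFst (CSnd (fld 1 0)); fld 2 0; fld 3 0; fld 4 0;
                   fld 5 0; last_fld 6 0 |>))
    (CPair (CCall 7 <| fld 0 0; fld 3 0; fld 4 0; last_fld 6 0 |>) (fld 5 0))).

(* disjunct, strategy, variable, state *)
Definition lp_aexp_code : Defs.code :=
  let cols d := CFst (CSnd (CFst (CSnd (fld 0 d)))) in
  let rows d := CSnd (CSnd (CFst (CSnd (fld 0 d)))) in
  let j d := CFst (CSnd (CSnd (fld 0 d))) in
  let ys d := CSnd (CSnd (CSnd (fld 0 d))) in
  CIfEqn (CFst (fld 0 0)) (CNat 0)
    (CIfPair (CSnd (fld 0 0))
      <| fld 3 0; CPair (CPair (CReal 1) (fld 2 0)) (fld 4 0);
         CPair (CPair (c_terms1 (CReal 1) (fld 2 0)) (CSnd (CSnd (fld 0 0))))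
           (last_fld 5 0) |>
      (last_fld 3 0))
    (CLet (CCall 1 (cols 0))
    (CLet (CCall 16 <| CFst (CFst (CSnd (fld 0 1))); fld 1 1; CVar 0; fld 3 1;
                       CAddn (fld 3 1) (CVar 0);
                       CAddn (CAddn (fld 3 1) (CVar 0)) (CVar 0); last_fld 5 1 |>)
      <| CSnd (CVar 0); CPair (CPair (CReal 1) (fld 2 2)) (fld 4 2);
         CPair
          (CPair (CPair (CPair (CReal 1) (fld 2 2))
                    (CCall 2 <| cols 2; CCall 3 <| rows 2; CNat 0; j 2 |>;
                                CAddn (fld 3 2) (CVar 1); minus_one |>))
             (CReal 0))
          (CCall 9 <| cols 2; rows 2; ys 2; fld 3 2; CFst (CVar 0) |>) |>)).

(* system, strategy, variable, state *)
Definition lp_sys_code : Defs.code :=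
  CIfPair (fld 0 0)
    (CLet (CCall 17 <| CCall 3 <| CFst (fld 0 0); CNat 0; CFst (CFst (fld 1 0)) |>;
                       CSnd (CFst (fld 1 0)); fld 2 0; last_fld 3 0 |>)
      (CCall 18 <| CSnd (fld 0 1); CSnd (fld 1 1); CAddn (CNat 1) (fld 2 1);
                   CVar 0 |>))
    (last_fld 3 0).

(* system, assignment, strategy *)
Definition lp_code : Defs.code :=
  CLet (CCall 1 (fld 1 0))
    (CCall 18 <| fld 0 1; last_fld 2 1; CNat 0; CVar 0; CNat 0; CNat 0 |>).

(* The numbers in [CCall] are positions in this list. *)
Definition prog (main : Defs.code) : program :=
  [:: main; len_code; lin_code; nth_code; assign_code; guard_code; copy_code;
      elem_code; conj_code; tmpl_code; flag_code; rho_code; stmt_code; aexp_code;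
      rhs_code; sat_code; lp_stmt_code; lp_aexp_code; lp_sys_code; lp_code].

Definition sat_prog : program := prog (CCall 15 (CVar 0)).
Definition lp_prog : program := prog (CCall 19 (CVar 0)).

(** * Correctness and running time of the programs *)

Section Evaluation.
Variables (R : realType) (main : Defs.code).
Let P := prog main.
Implicit Types (env : seq (tree R)) (v w : tree R).

(** An upper bound on the time composes additively, and [ev_conv] absorbs the slack at the end. *)
Definition ev env (c : Defs.code) v (B : nat) : Prop :=
  exists2 t, Defs.eval P env c v t & (t <= B)%N.

Lemma ev_conv env c v B v' B' :
  ev env c v B -> v = v' -> (B <= B')%N -> ev env c v' B'.
Proof. by case=> t e le <- le'; exists t => //; apply: leq_trans le'. Qed.

Lemma ev_var env i v : onth env i = Some v -> ev env (CVar i) v 1.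
Proof. by move=> e; exists 1%N => //; constructor. Qed.

Lemma ev_let env c d v w B1 B2 :
  ev env c v B1 -> ev (v :: env) d w B2 -> ev env (CLet c d) w (B1 + B2).+1.
Proof.
case=> t e le [u e' le']; exists (t + u).+1; first exact: eval_let e e'.
by rewrite ltnS leq_add.
Qed.

Lemma ev_call env f b c v w B1 B2 : onth P f = Some b ->
  ev env c v B1 -> ev [:: v] b w B2 -> ev env (CCall f c) w (B1 + B2).+1.
Proof.
move=> Pf [t e le] [u e' le']; exists (t + u).+1; first exact: eval_call Pf e e'.
by rewrite ltnS leq_add.
Qed.

Lemma ev_pair env c d v w B1 B2 :
  ev env c v B1 -> ev env d w B2 -> ev env (CPair c d) (TPair v w) (B1 + B2).+1.
Proof.
case=> t e le [u e' le']; exists (t + u).+1; first exact: eval_pair e e'.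
by rewrite ltnS leq_add.
Qed.

Lemma ev_fst env c v w B : ev env c (TPair v w) B -> ev env (CFst c) v B.+1.
Proof. by case=> t e le; exists t.+1 => //; apply: eval_fst e. Qed.

Lemma ev_snd env c v w B : ev env c (TPair v w) B -> ev env (CSnd c) w B.+1.
Proof. by case=> t e le; exists t.+1 => //; apply: eval_snd e. Qed.

Lemma ev_nat env k : ev env (CNat k) (TNat k) 1.
Proof. by exists 1%N => //; constructor. Qed.

Lemma ev_addn env c d k l B1 B2 : ev env c (TNat k) B1 -> ev env d (TNat l) B2 ->
  ev env (CAddn c d) (TNat (k + l)) (B1 + B2).+1.
Proof.
case=> t e le [u e' le']; exists (t + u).+1; first exact: eval_addn e e'.
by rewrite ltnS leq_add.
Qed.

Lemma ev_real env k : ev env (CReal k) (TReal k%:R) 1.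
Proof. by exists 1%N => //; constructor. Qed.

Lemma ev_opp env c a B : ev env c (TReal a) B -> ev env (COpp c) (TReal (- a)) B.+1.
Proof. by case=> t e le; exists t.+1 => //; apply: eval_opp e. Qed.

Lemma ev_mul env c d a b B1 B2 : ev env c (TReal a) B1 -> ev env d (TReal b) B2 ->
  ev env (CMul c d) (TReal (a * b)) (B1 + B2).+1.
Proof.
case=> t e le [u e' le']; exists (t + u).+1; first exact: eval_mul e e'.
by rewrite ltnS leq_add.
Qed.

Lemma ev_ifpair_pair env c d1 d2 v v' w B1 B2 :
  ev env c (TPair v v') B1 -> ev env d1 w B2 ->
  ev env (CIfPair c d1 d2) w (B1 + B2).+1.
Proof.
case=> t e le [u e' le']; exists (t + u).+1; last by rewrite ltnS leq_add.
exact: eval_ifpair e _.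
Qed.

Lemma ev_ifpair_nat env c d1 d2 k w B1 B2 :
  ev env c (TNat k) B1 -> ev env d2 w B2 ->
  ev env (CIfPair c d1 d2) w (B1 + B2).+1.
Proof.
case=> t e le [u e' le']; exists (t + u).+1; last by rewrite ltnS leq_add.
exact: eval_ifpair e _.
Qed.

Lemma ev_ifeqn env c1 c2 d1 d2 k l b w B1 B2 B3 :
  ev env c1 (TNat k) B1 -> ev env c2 (TNat l) B2 -> (k == l) = b ->
  ev env (if b then d1 else d2) w B3 ->
  ev env (CIfEqn c1 c2 d1 d2) w (B1 + B2 + B3).+1.
Proof.
case=> t1 e1 le1 [t2 e2 le2] <- [u e le]; exists (t1 + t2 + u).+1.
  exact: eval_ifeqn e1 e2 e.
by rewrite ltnS !leq_add.
Qed.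

Ltac ev_eqb :=
  first [ eassumption
        | lazymatch goal with |- ?x = _ =>
            let y := eval vm_compute in x in
            lazymatch y with
            | true => exact (erefl true : x = true)
            | false => exact (erefl false : x = false)
            end
          end ].

(** Symbolic execution directed by the code. Calls are closed by [tac], usually with the
    specification of the callee from the context; the last case unfolds abbreviations such as
    [fld]. *)
Ltac ev_run tac :=
  lazymatch goal with
  | |- ev _ (CVar _) _ _ => eapply ev_var; reflexivity
  | |- ev _ (CLet _ _) _ _ => eapply ev_let; [ev_run tac | ev_run tac]
  | |- ev _ (CCall _ _) _ _ => eapply ev_call; [reflexivity | ev_run tac | tac]
  | |- ev _ (CPair _ _) _ _ => eapply ev_pair; [ev_run tac | ev_run tac]
  | |- ev _ (CFst _) _ _ => eapply ev_fst; ev_run tac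
  | |- ev _ (CSnd _) _ _ => eapply ev_snd; ev_run tac
  | |- ev _ (CNat _) _ _ => eapply ev_nat
  | |- ev _ (CAddn _ _) _ _ => eapply ev_addn; [ev_run tac | ev_run tac]
  | |- ev _ (CReal _) _ _ => eapply ev_real
  | |- ev _ (COpp _) _ _ => eapply ev_opp; ev_run tac
  | |- ev _ (CMul _ _) _ _ => eapply ev_mul; [ev_run tac | ev_run tac]
  | |- ev _ (CIfPair _ _ _) _ _ =>
      first [ eapply ev_ifpair_pair; [solve [ev_run tac] | ]
            | eapply ev_ifpair_nat; [solve [ev_run tac] | ] ]; ev_run tac
  | |- ev _ (CIfEqn _ _ _ _) _ _ =>
      eapply ev_ifeqn; [ev_run tac | ev_run tac | ev_eqb | cbv iota; ev_run tac]
  | |- ev _ ?c _ _ => let c' := eval hnf in c in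
      change c with c'; ev_run tac
  end.

Ltac ev_call_hyp := idtac; match goal with H : _ |- _ => solve [eapply H] end.
Ltac ev_go := eapply ev_conv; [ev_run ev_call_hyp | | ].

Lemma len_ev (s : seq (tree R)) :
  ev [:: enc_seq s] len_code (TNat (size s)) (10 * size s + 10).
Proof.
elim: s => [|v s IH]; ev_go => //=; lia.
Qed.

Lemma tree_size_leaves (I : Type) (s : seq I) (f : I -> tree R) :
  (forall x, tree_size (f x) = 1%N) ->
  tree_size (enc_seq [seq f x | x <- s]) = (2 * size s).+1.
Proof. by move=> f1; elim: s => //= x s ->; rewrite f1; lia. Qed.

Lemma lin_map_ev n (s : seq 'I_n) (f : 'I_n -> R) u c :
  ev [:: TPair (enc_seq [seq TNat (val j) | j <- s])
        (TPair (enc_seq [seq TReal (f j) | j <- s]) (TPair (TNat u) (TReal c)))]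
    lin_code (enc_terms [seq (c * f j, (u + j)%N) | j <- s]) (80 * size s + 20).
Proof. elim: s => [|j s IH]; ev_go => //=; lia. Qed.

Definition enc_cols (n : nat) : tree R :=
  enc_seq [seq TNat (val j) | j <- enum 'I_n].

Definition enc_vec (n : nat) (f : 'I_n -> R) : tree R :=
  enc_seq [seq TReal (f j) | j <- enum 'I_n].

Definition enc_mat (k n : nat) (A : 'M[R]_(k, n)) (s : seq 'I_k) : tree R :=
  enc_seq [seq enc_vec (A i) | i <- s].

Definition enc_rows (rows : seq (lrow R)) : tree R :=
  enc_seq [seq TPair (enc_terms a.1) (TReal a.2) | a <- rows].

Lemma tree_size_vec n (f : 'I_n -> R) : tree_size (enc_vec f) = (2 * n).+1.
Proof. by rewrite tree_size_leaves // size_enum_ord. Qed.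

Lemma tree_size_cols n : tree_size (enc_cols n) = (2 * n).+1.
Proof. by rewrite tree_size_leaves // size_enum_ord. Qed.

Lemma tree_size_mat k n (A : 'M[R]_(k, n)) i s :
  tree_size (enc_mat A (i :: s)) = ((2 * n).+1 + tree_size (enc_mat A s)).+1.
Proof. by rewrite /= tree_size_vec. Qed.

Lemma size_le_tree_size (s : seq (tree R)) : (size s < tree_size (enc_seq s))%N.
Proof. elim: s => //= v s IH; lia. Qed.

Lemma lin_ev n (f : 'I_n -> R) u c :
  ev [:: TPair (enc_cols n) (TPair (enc_vec f) (TPair (TNat u) (TReal c)))]
    lin_code (enc_terms (lin c f u)) (80 * n + 20).
Proof. by have := lin_map_ev (enum 'I_n) f u c; rewrite size_enum_ord. Qed.

(** Time and encoding of a row are both proportional to [n], so the bound is linear in the input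
    though quadratic in [n]. *)
Lemma assign_ev n (A : 'M[R]_n) (b : 'cV[R]_n) i o s acc :
  ev [:: TPair (enc_cols n) (TPair (enc_seq [seq TNat (val k) | k <- s])
        (TPair (enc_mat A s) (TPair (enc_seq [seq TReal (b k 0) | k <- s])
        (TPair (TNat i) (TPair (TNat o) (enc_rows acc))))))]
    assign_code (enc_rows (assign_rows A b i o s acc))
    (300 * tree_size (enc_mat A s)).
Proof.
elim: s => [|k s IH]; first by ev_go.
have L1 := lin_ev (A k) i 1; have L2 := lin_ev (A k) i (- 1).
ev_go => //; rewrite tree_size_mat; lia.
Qed.

Lemma guard_ev k n (A : 'M[R]_(k, n)) (b : 'cV[R]_k) i s acc :
  ev [:: TPair (enc_cols n) (TPair (enc_mat A s)
        (TPair (enc_seq [seq TReal (b l 0) | l <- s])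
        (TPair (TNat i) (enc_rows acc))))]
    guard_code (enc_rows (guard_rows A b i s acc))
    (300 * tree_size (enc_mat A s)).
Proof.
elim: s => [|l s IH]; first by ev_go.
have L1 := lin_ev (A l) i 1.
ev_go => //; rewrite tree_size_mat; lia.
Qed.

Lemma copy_ev n i o (s : seq 'I_n) acc :
  ev [:: TPair (enc_seq [seq TNat (val k) | k <- s])
        (TPair (TNat i) (TPair (TNat o) (enc_rows acc)))]
    copy_code (enc_rows (copy_rows i o s acc)) (200 * size s + 200).
Proof. elim: s => [|k s IH]; ev_go => //=; lia. Qed.

Lemma tmpl_ev m n r (T : 'M[R]_(m, n)) (y : 'I_m -> 'I_r) u s acc :
  ev [:: TPair (enc_cols n) (TPair (enc_mat T s)
        (TPair (enc_seq [seq TNat (val (y i)) | i <- s])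
        (TPair (TNat u) (enc_rows acc))))]
    tmpl_code (enc_rows (tmpl_rows T y u s acc))
    (300 * tree_size (enc_mat T s)).
Proof.
elim: s => [|l s IH]; first by ev_go.
have L1 := lin_ev (T l) u 1.
ev_go => //; rewrite tree_size_mat; lia.
Qed.

Lemma flag_ev m r (y : 'I_m -> 'I_r) s acc :
  ev [:: TPair (enc_seq [seq TNat (val (y i)) | i <- s])
        (TPair (TNat r) (enc_rows acc))]
    flag_code (enc_rows (flag_rows y s acc)) (200 * size s + 200).
Proof. elim: s => [|k s IH]; ev_go => //=; lia. Qed.

(** The program counts variables itself; the hypothesis ties its counter to the entries of [s], for
    every suffix met in the induction. *)
Lemma rho_ev r (rho : assignment R r) s x : map val s = iota x (size s) ->
  ev [:: TPair (enc_seq [seq enc_ereal (rho z) | z <- s]) (TPair (TNat x) (TNat r))]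
    rho_code (enc_rows (rho_rows rho s)) (300 * size s + 200).
Proof.
elim: s x => [|z s IH] x; first by move=> _; ev_go.
case=> zx /IH {}IH; rewrite /= zx.
case: (rho z) => [c| |]; ev_go => //=; lia.
Qed.

Lemma conj_ev rows :
  ev [:: enc_rows rows] conj_code (enc_formula (conj rows)) (60 * size rows + 60).
Proof. elim: rows => [|a rows IH]; ev_go => //=; lia. Qed.

Lemma nth_ev (s : seq (tree R)) v0 c d : (d < size s)%N ->
  ev [:: TPair (enc_seq s) (TPair (TNat c) (TNat (c + d)))]
    nth_code (nth v0 s d) (60 * size s).
Proof.
elim: s c d => [|v s IH] c [|d] //=.
  have e : (c == c + 0)%N = true by rewrite addn0 eqxx.
  by move=> _; ev_go => //=; lia.
move=> /(IH c.+1) {}IH; rewrite addSnnS in IH.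
have e : (c == c + d.+1)%N = false by apply/eqP; lia.
ev_go => //=; lia.
Qed.

Lemma nth_enum_ev m (f : 'I_m -> tree R) (j : 'I_m) :
  ev [:: TPair (enc_seq [seq f i | i <- enum 'I_m])
        (TPair (TNat 0) (TNat (val j)))]
    nth_code (f j) (60 * m).
Proof.
have := @nth_ev [seq f i | i <- enum 'I_m] (f j) 0 j.
rewrite size_map size_enum_ord ltn_ord (nth_map j) ?size_enum_ord //.
by rewrite nth_ord_enum => /(_ isT).
Qed.

Lemma elem_ev n (s : stmt R n) i o acc : elementary s ->
  ev [:: TPair (enc_stmt s) (TPair (TNat i) (TPair (TNat o) (enc_rows acc)))]
    elem_code (enc_rows (elem_rows s i o acc)) (400 * tree_size (enc_stmt s)).
Proof.
case: s => // [A b|k A b] _.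
  have H := assign_ev A b i o (enum 'I_n) acc.
  ev_go => //=.
  rewrite -/(enc_vec _) -/(enc_mat A _) -/(enc_cols n); lia.
have H := guard_ev A b i (enum 'I_k) acc.
have C := copy_ev i o (enum 'I_n) (guard_rows A b i (enum 'I_k) acc).
rewrite size_enum_ord in C.
ev_go => //=.
rewrite -/(enc_vec _) -/(enc_mat A _) -/(enc_cols n) tree_size_cols; lia.
Qed.

Lemma size_foldr1 (I : Type) (f : I -> lrow R) acc s :
  size (foldr (fun i acc => f i :: acc) acc s) = (size s + size acc)%N.
Proof. by elim: s => //= i s ->. Qed.

Lemma size_foldr2 (I : Type) (f g : I -> lrow R) acc s :
  size (foldr (fun i acc => f i :: g i :: acc) acc s) = (2 * size s + size acc)%N.
Proof. by elim: s => //= i s ->; lia. Qed.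

Lemma size_mat k n (A : 'M[R]_(k, n)) : (k < tree_size (enc_mat A (enum 'I_k)))%N.
Proof.
have := size_le_tree_size [seq enc_vec (A i) | i <- enum 'I_k].
by rewrite size_map size_enum_ord.
Qed.

(** The encoded column list pays for the copy rows of a guard even when its matrix has no rows. *)
Lemma tree_size_stmt n (s : stmt R n) : elementary s ->
  (2 * n + size (elem_rows s 0 0 [::]) < tree_size (enc_stmt s) * 2)%N.
Proof.
case: s => // [A b|k A b] _ /=.
  rewrite -/(enc_vec _) -/(enc_mat A _) -/(enc_cols n) tree_size_cols.
  by rewrite /assign_rows size_foldr2 size_enum_ord /=; lia.
rewrite -/(enc_vec _) -/(enc_mat A _) -/(enc_cols n) tree_size_cols.
rewrite /copy_rows size_foldr2 /guard_rows size_foldr1 !size_enum_ord /=.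
have := size_mat A; lia.
Qed.

Lemma size_elem_rows n (s : stmt R n) i o :
  size (elem_rows s i o [::]) = size (elem_rows s 0 0 [::]).
Proof.
case: s => //= [A b|k A b]; first by rewrite /assign_rows !size_foldr2.
by rewrite /copy_rows !size_foldr2 /guard_rows !size_foldr1.
Qed.

(** A sequence or choice node adds 3 to the tree size; the resulting 2700 units pay for its own
    work. *)
Lemma stmt_ev n (s : stmt R n) i o b f :
  ev [:: TPair (enc_stmt s) (TPair (TNat n) (TPair (TNat i) (TPair (TNat o)
        (TPair (TNat b) (TNat f)))))]
    stmt_code (TPair (enc_formula (stmt_form s i o b f))
                 (TPair (TNat (next_bool s b)) (TNat (next_real s f))))
    (900 * tree_size (enc_stmt s)).
Proof.
elim: s i o b f => [A c|k A c|s0 IH0 s1 IH1|s0 IH0 s1 IH1] i o b f.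
- have H := @elem_ev n (Assign A c) i o [::] isT.
  have C := conj_ev (elem_rows (Assign A c) i o [::]).
  have := @tree_size_stmt n (Assign A c) isT.
  rewrite -(size_elem_rows (Assign A c) i o) => lt.
  ev_go => //; lia.
- have H := @elem_ev n (Guard A c) i o [::] isT.
  have C := conj_ev (elem_rows (Guard A c) i o [::]).
  have := @tree_size_stmt n (Guard A c) isT.
  rewrite -(size_elem_rows (Guard A c) i o) => lt.
  ev_go => //; lia.
- have H0 := IH0 i f b (f + n)%N.
  have H1 := IH1 f o (next_bool s0 b) (next_real s0 (f + n)).
  ev_go => //=; lia.
- have H0 := IH0 i o b.+1 f.
  have H1 := IH1 i o (next_bool s0 b.+1) (next_real s0 f).
  ev_go => //=; lia.
Qed.

Section SystemPrograms.
Variables (n m r : nat) (T : 'M[R]_(m, n)).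

(** The real counter returned by [aexp_code], which [rhs_code] discards because the disjuncts share
    their real variables. *)
Definition aexp_real (a : aexp R n m r) : nat :=
  if a is Abs s _ _ then next_real s (r + r + n + n) else 0.

Lemma tree_size_abs (s : stmt R n) j (y : 'I_m -> 'I_r) :
  tree_size (enc_aexp T (Abs s j y)) =
  (9 + tree_size (enc_stmt s) + 2 * n + 2 * m +
   tree_size (enc_mat T (enum 'I_m)))%N.
Proof.
rewrite /= -/(enc_cols n) tree_size_cols.
rewrite (@tree_size_leaves _ (enum 'I_m) (fun i => TNat (val (y i)))) //.
by rewrite size_enum_ord -/(enc_vec _) -/(enc_mat T _); lia.
Qed.

Lemma aexp_ev (a : aexp R n m r) b x :
  ev [:: TPair (enc_aexp T a) (TPair (TNat b) (TPair (TNat r) (TNat x)))]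
    aexp_code (TPair (enc_formula (aexp_form T a b x))
                 (TPair (TNat (aexp_next a b)) (TNat (aexp_real a))))
    (1200 * tree_size (enc_aexp T a)).
Proof.
case: a => [[c| |]|s j y]; [by ev_go|by ev_go|by ev_go|].
have H1 := len_ev [seq TNat (val j) | j <- enum 'I_n].
rewrite size_map size_enum_ord in H1.
have H2 := stmt_ev s (r + r) (r + r + n) b (r + r + n + n).
have H3 := tmpl_ev T y (r + r) (enum 'I_m) [::].
have H4 := flag_ev y (enum 'I_m) (tmpl_rows T y (r + r) (enum 'I_m) [::]).
have H5 := conj_ev
  (flag_rows y (enum 'I_m) (tmpl_rows T y (r + r) (enum 'I_m) [::])).
have H6 := nth_enum_ev (fun i => enc_vec (T i)) j.
have H7 := lin_ev (T j) (r + r + n) 1.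
have := size_mat T; rewrite tree_size_abs.
rewrite /flag_rows /tmpl_rows !size_foldr1 size_enum_ord /= addn0 in H4 H5.
move=> lt; ev_go => //; lia.
Qed.

Lemma rhs_ev (e : rhs R n m r) b D x :
  ev [:: TPair (enc_seq [seq enc_aexp T a | a <- e]) (TPair (TNat b)
        (TPair (enc_formula D) (TPair (TNat r) (TNat x))))]
    rhs_code (enc_formula (rhs_form T e b D x))
    (1400 * tree_size (enc_seq [seq enc_aexp T a | a <- e])).
Proof.
elim: e b D => [|a e IH] b D; first by ev_go.
have H := aexp_ev a b.+1 x.
have {}IH := IH (aexp_next a b.+1) (FOr (FBool R b) D).
ev_go => //=; lia.
Qed.

Lemma nth_system_size (E : system R n m r) (x : 'I_r) :
  (tree_size (enc_seq [seq enc_aexp T a | a <- E x]) + r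
     <= tree_size (enc_system T E))%N.
Proof.
have H s : x \in s ->
    (tree_size (enc_seq [seq enc_aexp T a | a <- E x]) + size s
       <= tree_size (enc_seq
            [seq enc_seq [seq enc_aexp T a | a <- E z] | z <- s]))%N.
  elim: s => //= y s IH; rewrite inE => /orP[/eqP <-|/IH]; last by lia.
  have := size_le_tree_size [seq enc_seq [seq enc_aexp T a | a <- E z] | z <- s].
  by rewrite size_map; lia.
by have := H (enum 'I_r) (mem_enum _ _); rewrite size_enum_ord.
Qed.

Lemma sat_ev (E : system R n m r) rho (x : 'I_r) :
  ev [:: sat_input T E rho x] sat_code (enc_formula (sat_form T E rho x))
    (2000 * tree_size (sat_input T E rho x)).
Proof.
have H1 := len_ev [seq enc_ereal (rho z) | z <- enum 'I_r].
have H2 := @rho_ev r rho (enum 'I_r) 0.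
rewrite size_map size_enum_ord val_enum_ord in H1 H2.
have {}H2 := H2 erefl.
have H3 := conj_ev (rho_rows rho (enum 'I_r)).
have H4 := nth_enum_ev (fun z => enc_seq [seq enc_aexp T a | a <- E z]) x.
have H5 := rhs_ev (E x) 0 (FNot (FTrue R)) x.
have le := nth_system_size E x.
have le2 : (size (rho_rows rho (enum 'I_r)) <= 3 * r)%N.
  have H s : (size (rho_rows rho s) <= 3 * size s)%N.
    by elim: s => //= z s; case: (rho z) => [c| |] /=; lia.
  by have := H (enum 'I_r); rewrite size_enum_ord.
rewrite /sat_input; ev_go => //=; lia.
Qed.

(** The strategy is resolved while statement and strategy tree are walked in parallel; the
    sequential statement is never built. *)
Lemma lp_stmt_ev (s : stmt R n) g i o f acc :
  ev [:: TPair (enc_stmt s) (TPair (enc_strat_stmt s g) (TPair (TNat n)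
        (TPair (TNat i) (TPair (TNat o) (TPair (TNat f) (enc_rows acc))))))]
    lp_stmt_code (TPair (enc_rows (stmt_rows (stmt_app s g) i o f acc))
                    (TNat (next_real (stmt_app s g) f)))
    (900 * tree_size (enc_stmt s)).
Proof.
elim: s g i o f acc => [A c|k A c|s0 IH0 s1 IH1|s0 IH0 s1 IH1] g i o f acc.
- have H := @elem_ev n (Assign A c) i o acc isT.
  have lt := @tree_size_stmt n (Assign A c) isT; ev_go => //; lia.
- have H := @elem_ev n (Guard A c) i o acc isT.
  have lt := @tree_size_stmt n (Guard A c) isT; ev_go => //; lia.
- have H0 := IH0 (fun p => g (false :: p)) i f (f + n)%N acc.
  set acc0 := stmt_rows _ _ _ _ _ in H0; set f0 := next_real _ _ in H0.
  have H1 := IH1 (fun p => g (true :: p)) f o f0 acc0.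
  ev_go => //=; lia.
- have H0 := IH0 (fun p => g (false :: p)) i o f acc.
  have H1 := IH1 (fun p => g (true :: p)) i o f acc.
  rewrite /=; case: (g [::]); ev_go => //=; lia.
Qed.

Definition enc_state (st : lp_state R) : tree R :=
  TPair (TNat st.1) (TPair (enc_terms st.2.1) (enc_rows st.2.2)).

Lemma lp_aexp_ev (a : aexp R n m r) g x st :
  ev [:: TPair (enc_aexp T a) (TPair (enc_strat_aexp a g) (TPair (TNat x)
        (enc_state st)))]
    lp_aexp_code (enc_state (lp_aexp T (aexp_app a g) x st))
    (1400 * tree_size (enc_aexp T a)).
Proof.
case: st => f [obj rows]; case: a => [[c| |]|s j y];
  [by ev_go|by ev_go|by ev_go|].
have H1 := len_ev [seq TNat (val j) | j <- enum 'I_n].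
rewrite size_map size_enum_ord in H1.
have H2 := lp_stmt_ev s g f (f + n) (f + n + n) rows.
set rows' := stmt_rows _ _ _ _ _ in H2.
have H3 := tmpl_ev T y f (enum 'I_m) rows'.
have H6 := nth_enum_ev (fun i => enc_vec (T i)) j.
have H7 := lin_ev (T j) (f + n) (- 1).
have := size_mat T; rewrite tree_size_abs => lt.
ev_go => //; lia.
Qed.

Lemma lp_sys_ev (E : system R n m r) (sg : strategy E) s x st :
  map val s = iota x (size s) ->
  ev [:: TPair (enc_seq [seq enc_seq [seq enc_aexp T a | a <- E z] | z <- s])
        (TPair (enc_seq [seq TPair (TNat (val (tag (sg z))))
               (enc_strat_aexp (tnth (in_tuple (E z)) (tag (sg z)))
                  (strat_fun (tagged (sg z)))) | z <- s])
        (TPair (TNat x) (enc_state st)))]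
    lp_sys_code
    (enc_state (foldl (fun st z => lp_aexp T (rhs_app (sg z)) z st) st s))
    (1600 * tree_size
       (enc_seq [seq enc_seq [seq enc_aexp T a | a <- E z] | z <- s])).
Proof.
elim: s x st => [|z s IH] x st; first by move=> _; ev_go.
case=> zx /IH {}IH.
have {}IH := IH (lp_aexp T (rhs_app (sg z)) z st).
set l := tag (sg z); set a := tnth (in_tuple (E z)) l.
have H1 : ev [:: TPair (enc_seq [seq enc_aexp T a | a <- E z])
      (TPair (TNat 0) (TNat (val l)))] nth_code (enc_aexp T a)
    (60 * size (E z)).
  have := @nth_ev [seq enc_aexp T a | a <- E z] (enc_aexp T a) 0 l.
  rewrite size_map ltn_ord (nth_map a) // -(tnth_nth _ (in_tuple (E z))).
  by move=> /(_ isT).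
have H2 := lp_aexp_ev a (strat_fun (tagged (sg z))) x st.
rewrite -zx in IH H2 *.
have := size_le_tree_size [seq enc_aexp T a | a <- E z]; rewrite size_map => lt.
have lea : (tree_size (enc_aexp T a)
    <= tree_size (enc_seq [seq enc_aexp T a | a <- E z]))%N.
  have : (val l < size (E z))%N by exact: ltn_ord.
  rewrite /a (tnth_nth a) /=; elim: (E z) (val l) => //= b e IHe [|k] /=.
    by move=> _; lia.
  by move=> /IHe; lia.
ev_go => //=; lia.
Qed.

Lemma lp_ev (E : system R n m r) (sg : strategy E) rho :
  ev [:: lp_input T rho sg] lp_code
    (enc_lp (lp_system T (fun x => rhs_app (sg x))))
    (2000 * tree_size (lp_input T rho sg)).
Proof.
have H1 := len_ev [seq enc_ereal (rho z) | z <- enum 'I_r].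
rewrite size_map size_enum_ord in H1.
have H2 := @lp_sys_ev E sg (enum 'I_r) 0 (r, ([::], [::])).
rewrite size_enum_ord val_enum_ord in H2; have {}H2 := H2 erefl.
have := size_le_tree_size
  [seq enc_seq [seq enc_aexp T a | a <- E z] | z <- enum 'I_r].
rewrite size_map size_enum_ord => lt.
rewrite /lp_input /enc_system /enc_strategy; ev_go => //=; lia.
Qed.

End SystemPrograms.

End Evaluation.

Lemma ev_constructs (R : realType) (k : nat) b (v w : tree R) B C :
  onth (prog (CCall k (CVar 0))) k = Some b ->
  ev (CCall k (CVar 0)) [:: v] b w B -> (B + 5 <= C * tree_size v)%N ->
  constructs (prog (CCall k (CVar 0))) C v w.
Proof.
move=> Pk [t e le] leC; exists (1 + (1 + t).+1).+1; last by lia.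
apply: eval_call => //; first exact: eval_var.
by apply: eval_call Pk _ e; apply: eval_var.
Qed.

Lemma tree_size_gt0 (R : realType) (v : tree R) : (0 < tree_size v)%N.
Proof. by case: v. Qed.

(** A model gives a strictly better choice, and unsatisfiability certifies that the variable cannot
    be improved. *)
Lemma next_strategy_improvement (R : realType) (n m r : nat) (T : 'M[R]_(m, n))
    (E : system R n m r) (mu : assignment R r) (sg : strategy (or_bot E))
    (rho : assignment R r) (ans : 'I_r -> option (valuation R)) :
  (forall x, (mu x < +oo)%E) -> strat_inv T mu sg rho ->
  (forall x, sat_answer (sat_form T (or_bot E) rho x) (ans x)) ->
  improvement T rho sg (next_strategy sg ans).
Proof.
move=> mu_fin inv_sg ansP; have fin := inv_fin mu_fin inv_sg.
apply: (improvement_intro inv_sg) => x; rewrite /next_strategy ffunE;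
  have := ansP x; case: (ans x) => [M /sat_form_sound-> //|noM].
  by rewrite eqxx.
by move=> /(sat_form_complete fin)[M]; rewrite (negbTE (noM M)).
Qed.

Theorem theorem20 (R : realType) :
  exists (satP lpP : program) (C : nat),
  forall (n m r : nat) (T : 'M[R]_(m, n)) (E : system R n m r)
    (mu : assignment R r),
    (forall x, (0 < size (E x))%N) ->
    least_solution T E mu ->
    (forall x, (mu x < +oo)%E) ->
    forall (k : nat) (sg : strategy (or_bot E)) (rho : assignment R r),
    run T k sg rho ->
    [/\ (k <= #|strategy E| + #|'I_r|)%N,
        (solution T (or_bot E) rho -> rho = mu) &
        (~ solution T (or_bot E) rho ->
         [/\ (exists sg' rho', step T sg rho sg' rho'),
             (exists phi : 'I_r -> lra_formula R,
                (forall x,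
                   constructs satP C (sat_input T (or_bot E) rho x)
                     (enc_formula (phi x))) /\
                (forall ans : 'I_r -> option (valuation R),
                   (forall x, sat_answer (phi x) (ans x)) ->
                   improvement T rho sg (next_strategy sg ans))) &
             (forall sg' : strategy (or_bot E),
                improvement T rho sg sg' ->
                exists L : lp R,
                  [/\ constructs lpP C (lp_input T rho sg') (enc_lp L),
                      (exists z, @lp_optimal R L z) &
                      (forall z, @lp_optimal R L z ->
                         least_solution_ge T (sys_app sg') rho
                           (asg_of_lp sg' z))])])].
Proof.
(* 2000 from [sat_ev] and [lp_ev]; the remaining 10 cover the initial calls, as an input has size at
   least 1. *)
exists sat_prog, lp_prog, 2010%N.
move=> n m r T E mu E_gt0 [mu_sol mu_least] mu_fin k sg rho runk.
have [inv_sg _] := run_inv mu_sol mu_fin E_gt0 runk.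
split; first exact: run_length mu_sol mu_fin E_gt0 _ _ _ runk.
  move=> /solution_or_bot/mu_least le; apply/funext => x; apply/eqP.
  by rewrite eq_le le andbT; case: inv_sg.
move=> nsol.
have imp ans := @next_strategy_improvement R n m r T E mu sg rho ans mu_fin inv_sg.
split.
(* The existence of a step follows from the SAT formulas themselves, with answers chosen
   classically. *)
- have H x : exists a, sat_answer (sat_form T (or_bot E) rho x) a.
    have [[M mM]|noM] := pselect (exists M, models M (sat_form T (or_bot E) rho x)).
      by exists (Some M).
    by exists None => M; apply/negP => mM; apply: noM; exists M.
  pose ans x := sval (cid (H x)).
  have ansP x : sat_answer (sat_form T (or_bot E) rho x) (ans x).
    exact: svalP (cid (H x)).
  have [rho' least _] :=
    least_solution_ge_exists (improvement_presolution nsol (imp ans ansP)).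
  by exists (next_strategy sg ans), rho'; split=> //; apply: imp.
- exists (sat_form T (or_bot E) rho); split=> // x.
  apply: ev_constructs (sat_ev _ T (or_bot E) rho x) _ => //.
  by have := tree_size_gt0 (sat_input T (or_bot E) rho x); lia.
- move=> sg' imp'.
  have [rho' least _] :=
    least_solution_ge_exists (improvement_presolution nsol imp').
  exists (lp_system T (fun x => rhs_app (sg' x))); split.
  + apply: ev_constructs (lp_ev _ T sg' rho) _ => //.
    by have := tree_size_gt0 (lp_input T rho sg'); lia.
  + exact (lp_system_has_optimum mu_sol mu_fin inv_sg nsol imp' least).
  + exact (lp_system_optimal mu_sol mu_fin inv_sg nsol imp' least).
Qed.
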